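(* Let $\mathcal{A}=(\partial\colon A\to B,\gtrdot,\lessdot)$ be a unital crossed module of bare algebras over $\mathbb{C}$. The algebra maps $\xi^\sharp_A\colon\mathcal{U}({\rm Lie}(A))\to A_\bullet$ and $\xi_B\colon\mathcal{U}({\rm Lie}(B))\to B$ induce (by $\mathbb{C}[[h]]$-linear extension and restriction) a map of crossed modules of groups $${\rm Proj}_{\mathcal{A}}\colon\mathcal{U}({\rm Lie}(\mathcal{A}))^*_{\rm gl}\to\mathcal{A}^*_\bullet .$$
   Context: A bare algebra is an associative $\mathbb{C}$-algebra, with or without identity; $h$ is a formal parameter; structures are extended termwise to power series. A crossed module of bare algebras $\mathcal{A}=(\partial\colon A\to B,\gtrdot,\lessdot)$: an algebra map $\partial\colon A\to B$ and bilinear maps $(b,a)\mapsto b\gtrdot a\in A$, $(a,b)\mapsto a\lessdot b\in A$ with $(bb')\gtrdot a=b\gtrdot(b'\gtrdot a)$, $a\lessdot(bb')=(a\lessdot b)\lessdot b'$, $b\gtrdot(aa')=(b\gtrdot a)a'$, $(aa')\lessdot b=a(a'\lessdot b)$, $b\gtrdot(a\lessdot b')=(b\gtrdot a)\lessdot b'$, $(a\lessdot b)(b'\gtrdot a')=a((bb')\gtrdot a')=(a\lessdot(bb'))a'$, $\partial(b\gtrdot a)=b\partial(a)$, $\partial(a\lessdot b)=\partial(a)b$, $\partial(a')\gtrdot a=a'a$, $a\lessdot\partial(a')=aa'$. It is unital if $B$ has an identity $1_B$ with $1_B\gtrdot a=a=a\lessdot1_B$. $A_\bullet=\mathbb{C}\oplus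 A$ is $A$ with an identity $1$ adjoined. $A_\bullet^*$ is the group of series $1+\sum_{n\ge1}h^na_n\in A_\bullet[[h]]$ with $a_n\in A$; $B^*$ is the group of series $1_B+\sum_{n\ge1}h^nb_n\in B[[h]]$; with $\partial(1+\sum h^na_n)=1_B+\sum h^n\partial(a_n)$ and $b\triangleright(1+a)=1+b\gtrdot a\lessdot b^{-1}$, $\mathcal{A}^*_\bullet=(\partial\colon A_\bullet^*\to B^*,\triangleright)$ is a crossed module of groups. ${\rm Lie}(A)$ is $A$ with commutator bracket; ${\rm Lie}(\mathcal{A})=(\partial\colon{\rm Lie}(A)\to{\rm Lie}(B),\triangleright)$, $b\triangleright a=b\gtrdot a-a\lessdot b$, is a crossed module of Lie algebras. Each $x\in{\rm Lie}(B)$ acts on the universal enveloping algebra $\mathcal{U}({\rm Lie}(A))$ by the unique algebra derivation extending $a\mapsto x\triangleright a$; this extends to an algebra action (written $\triangleright$) of $\mathcal{U}({\rm Lie}(B))$ on $\mathcal{U}({\rm Lie}(A))$, making $\mathcal{U}({\rm Lie}(\mathcal{A}))=(\partial\colon\mathcal{U}({\rm Lie}(A))\to\mathcal{U}({\rm Lie}(B)),\triangleright)$ a crossed module of Hopf algebras (with the standard Hopf structures, elements of the Lie algebras being primitive). For a Hopf algebra $H$, $x=\sum h^nx_n\in H[[h]]$ is group-like if $\Delta(x_n)=\sum_{i+j=n}x_i\otimes x_j$ for all $n$; $H^*_{\rm gl}$ is the group of invertible group-like elements of $H[[h]]$ of the form $1_H+\sum_{n\ge1}h^nx_n$. $\mathcal{U}({\rm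 Lie}(\mathcal{A}))^*_{\rm gl}=(\partial\colon\mathcal{U}({\rm Lie}(A))^*_{\rm gl}\to\mathcal{U}({\rm Lie}(B))^*_{\rm gl},\triangleright)$ is the induced crossed module of groups. $\xi_B$ is the unital algebra map with $\xi_B(x)=x$ for $x\in B$; $\xi_A^\sharp$ is the unital algebra map with $\xi_A^\sharp(a)=(0,a)$ for $a\in A$. A map of crossed modules of groups is a pair of group homomorphisms commuting with the boundary maps and intertwining the actions. *)

(* Defs.v *)
From HB Require Import structures.
From mathcomp Require Import all_boot all_order all_algebra.
From mathcomp Require Import generic_quotient boolp.

Set Implicit Arguments.
Unset Strict Implicit.
Unset Printing Implicit Defensive.

Import GRing.Theory.
Local Open Scope quotient_scope.
Local Open Scope ring_scope.

Section Linear.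
Variables (K : fieldType) (U V W : lmodType K).

Lemma linear_D (f : U -> V) : linear f -> {morph f : x y / x + y}.
Proof. by move=> fl x y; have := fl 1 x y; rewrite !scale1r. Qed.
Lemma linear_0 (f : U -> V) : linear f -> f 0 = 0.
Proof.
by move=> fl; have := linear_D fl 0 0; rewrite addr0 -{1}[f 0]addr0 => /addrI.
Qed.
Lemma linear_Z (f : U -> V) : linear f -> forall c x, f (c *: x) = c *: f x.
Proof.
by move=> fl c x; have := fl c x 0; rewrite !addr0 linear_0 // addr0.
Qed.
Lemma linear_N (f : U -> V) : linear f -> {morph f : x / - x}.
Proof. by move=> fl x; rewrite -scaleN1r linear_Z // scaleN1r. Qed.
Lemma linear_bigsum (f : U -> V) : linear f -> forall I r (P : pred I) F,
  f (\sum_(i <- r | P i) F i) = \sum_(i <- r | P i) f (F i).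
Proof.
by move=> fl I r P F; apply: (big_morph f (linear_D fl) (linear_0 fl)).
Qed.

Definition bilin (f : U -> V -> W) :=
  (forall x, linear (f x)) /\ (forall y, linear (f^~ y)).
End Linear.

HB.mixin Record isBareAlgebra (K : fieldType) V of GRing.Lmodule K V := {
  bmul : V -> V -> V;
  bmulA : associative bmul;
  bmul_bilin : bilin bmul
}.
#[short(type="bareAlgType")]
HB.structure Definition BareAlgebra (K : fieldType) :=
  {V of GRing.Lmodule K V & isBareAlgebra K V}.
Notation "x ** y" := (bmul x y) (at level 40, left associativity) : ring_scope.

(* Unlike [algType], this does not exclude the zero algebra. *)
HB.mixin Record hasIdentity (K : fieldType) V of BareAlgebra K V := {
  bone : V;
  bmul1 : left_id bone (@bmul K V);
  bmulr1 : right_id bone (@bmul K V)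
}.
#[short(type="unitalAlgType")]
HB.structure Definition UnitalAlgebra (K : fieldType) :=
  {V of BareAlgebra K V & hasIdentity K V}.

HB.mixin Record isLieAlgebra (K : fieldType) V of GRing.Lmodule K V := {
  brk : V -> V -> V;
  brk_bilin : bilin brk;
  brkxx : forall x, brk x x = 0;
  brk_jacobi : forall x y z,
    brk x (brk y z) + brk y (brk z x) + brk z (brk x y) = 0
}.
#[short(type="lieAlgType")]
HB.structure Definition LieAlgebra (K : fieldType) :=
  {V of GRing.Lmodule K V & isLieAlgebra K V}.

Definition unital_alg_hom (K : fieldType) (U V : unitalAlgType K) (f : U -> V) :=
  [/\ linear f, f bone = bone & {morph f : x y / x ** y}].

Section BareTheory.
Variables (K : fieldType) (V : bareAlgType K).
Implicit Types x y z : V.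
Lemma bmulDl x y z : (x + y) ** z = x ** z + y ** z.
Proof. exact: (linear_D (bmul_bilin.2 z)). Qed.
Lemma bmulDr x y z : x ** (y + z) = x ** y + x ** z.
Proof. exact: (linear_D (bmul_bilin.1 x)). Qed.
Lemma bmulNl x y : (- x) ** y = - (x ** y).
Proof. exact: (linear_N (bmul_bilin.2 y)). Qed.
Lemma bmulNr x y : x ** (- y) = - (x ** y).
Proof. exact: (linear_N (bmul_bilin.1 x)). Qed.
Lemma bmul0l x : 0 ** x = 0.
Proof. exact: (linear_0 (bmul_bilin.2 x)). Qed.
Lemma bmul0r x : x ** 0 = 0.
Proof. exact: (linear_0 (bmul_bilin.1 x)). Qed.
Lemma bmulZl c x y : (c *: x) ** y = c *: (x ** y).
Proof. exact: (linear_Z (bmul_bilin.2 y)). Qed.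
Lemma bmulZr c x y : x ** (c *: y) = c *: (x ** y).
Proof. exact: (linear_Z (bmul_bilin.1 x)). Qed.
Lemma bmulBl x y z : (x - y) ** z = x ** z - y ** z.
Proof. by rewrite bmulDl bmulNl. Qed.
Lemma bmulBr x y z : x ** (y - z) = x ** y - x ** z.
Proof. by rewrite bmulDr bmulNr. Qed.
End BareTheory.

Section Enveloping.
Variables (K : fieldType) (g : lieAlgType K).

Inductive uexpr : Type :=
  | UScal of K | UGen of g | UAdd of uexpr & uexpr | UMul of uexpr & uexpr.
HB.instance Definition _ := gen_eqMixin uexpr.
HB.instance Definition _ := gen_choiceMixin uexpr.

(* The congruence presenting U(g) as the unital associative algebra generated *)
(* by the vector space g subject to [x, y] = x y - y x.                       *)
Inductive ueq : uexpr -> uexpr -> Prop :=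
  | ueq_refl s : ueq s s
  | ueq_sym s t : ueq s t -> ueq t s
  | ueq_trans s t r : ueq s t -> ueq t r -> ueq s r
  | ueq_add s s' t t' : ueq s s' -> ueq t t' -> ueq (UAdd s t) (UAdd s' t')
  | ueq_mul s s' t t' : ueq s s' -> ueq t t' -> ueq (UMul s t) (UMul s' t')
  | ueq_addA s t r : ueq (UAdd s (UAdd t r)) (UAdd (UAdd s t) r)
  | ueq_addC s t : ueq (UAdd s t) (UAdd t s)
  | ueq_add0 s : ueq (UAdd (UScal 0) s) s
  | ueq_addN s : ueq (UAdd (UMul (UScal (-1)) s) s) (UScal 0)
  | ueq_mulA s t r : ueq (UMul s (UMul t r)) (UMul (UMul s t) r)
  | ueq_mul1 s : ueq (UMul (UScal 1) s) s
  | ueq_mulDl s t r : ueq (UMul (UAdd s t) r) (UAdd (UMul s r) (UMul t r))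
  | ueq_mulDr s t r : ueq (UMul s (UAdd t r)) (UAdd (UMul s t) (UMul s r))
  | ueq_scalC c s : ueq (UMul (UScal c) s) (UMul s (UScal c))
  | ueq_scalD c d : ueq (UScal (c + d)) (UAdd (UScal c) (UScal d))
  | ueq_scalM c d : ueq (UScal (c * d)) (UMul (UScal c) (UScal d))
  | ueq_genD x y : ueq (UGen (x + y)) (UAdd (UGen x) (UGen y))
  | ueq_genZ c x : ueq (UGen (c *: x)) (UMul (UScal c) (UGen x))
  | ueq_brk x y : ueq (UAdd (UGen (brk x y)) (UMul (UGen y) (UGen x)))
                      (UMul (UGen x) (UGen y)).

Definition ueqb s t := `[< ueq s t >].
Lemma ueqb_equiv : equiv_class_of ueqb.
Proof.
split=> [s|s t|t s r]; first exact/asboolP/ueq_refl.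
  by apply/asboolP/asboolP; apply: ueq_sym.
by move=> /asboolP st /asboolP tr; apply/asboolP/(ueq_trans st).
Qed.
Canonical ueqb_equiv_rel := EquivRelPack ueqb_equiv.

Definition Uenv := {eq_quot ueqb}.
HB.instance Definition _ := Choice.on Uenv.
HB.instance Definition _ := EqQuotient.on Uenv.

Definition upi (s : uexpr) : Uenv := \pi_Uenv s.

Lemma upiP s t : upi s = upi t <-> ueq s t.
Proof.
by rewrite /upi; split=> [/eqmodP/asboolP|h]; last exact/eqmodP/asboolP.
Qed.
Lemma upi_repr u : upi (repr u) = u. Proof. exact: reprK. Qed.
Lemma repr_upi s : ueq (repr (upi s)) s. Proof. by apply/upiP;
  rewrite upi_repr. Qed.

Definition uadd (u v : Uenv) := upi (UAdd (repr u) (repr v)).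
Definition umul (u v : Uenv) := upi (UMul (repr u) (repr v)).
Definition uscale c (u : Uenv) := upi (UMul (UScal c) (repr u)).
Definition uopp (u : Uenv) := uscale (-1) u.
Definition uzero : Uenv := upi (UScal 0).
Definition uone : Uenv := upi (UScal 1).

Lemma upiD s t : upi (UAdd s t) = uadd (upi s) (upi t).
Proof. by apply/upiP; apply: ueq_add; apply: ueq_sym; apply: repr_upi. Qed.
Lemma upiM s t : upi (UMul s t) = umul (upi s) (upi t).
Proof. by apply/upiP; apply: ueq_mul; apply: ueq_sym; apply: repr_upi. Qed.
Lemma upiZ c s : uscale c (upi s) = upi (UMul (UScal c) s).
Proof. by rewrite [RHS]upiM /uscale [LHS]upiM upi_repr. Qed.

Lemma uind (P : Uenv -> Prop) : (forall s, P (upi s)) -> forall u, P u.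
Proof. by move=> h u; rewrite -(upi_repr u). Qed.

Fact uaddA : associative uadd.
Proof.
by elim/uind=> s; elim/uind=> t; elim/uind=> r; rewrite -!upiD;
  apply/upiP/ueq_addA.
Qed.
Fact uaddC : commutative uadd.
Proof.
by elim/uind=> s; elim/uind=> t; rewrite -!upiD; apply/upiP/ueq_addC.
Qed.
Fact uadd0 : left_id uzero uadd.
Proof. by elim/uind=> s; rewrite -!upiD; apply/upiP/ueq_add0. Qed.
Fact uaddN : left_inverse uzero uopp uadd.
Proof. by elim/uind=> s; rewrite /uopp upiZ -!upiD; apply/upiP/ueq_addN. Qed.
HB.instance Definition _ := GRing.isZmodule.Build Uenv uaddA uaddC uadd0 uaddN.

Fact umulA : associative umul.
Proof.
by elim/uind=> s; elim/uind=> t; elim/uind=> r; rewrite -!upiM;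
  apply/upiP/ueq_mulA.
Qed.
Fact umul1 : left_id uone umul.
Proof. by elim/uind=> s; rewrite -!upiM; apply/upiP/ueq_mul1. Qed.
Fact umulr1 : right_id uone umul.
Proof.
elim/uind=> s; rewrite -!upiM; apply/upiP.
by apply: ueq_trans (ueq_mul1 s); apply/ueq_sym/ueq_scalC.
Qed.
Fact umulDl : left_distributive umul uadd.
Proof.
by elim/uind=> s; elim/uind=> t; elim/uind=> r; rewrite -!(upiD, upiM);
  apply/upiP/ueq_mulDl.
Qed.
Fact umulDr : right_distributive umul uadd.
Proof.
by elim/uind=> s; elim/uind=> t; elim/uind=> r; rewrite -!(upiD, upiM);
  apply/upiP/ueq_mulDr.
Qed.
Fact uscaleE c u : uscale c u = umul (upi (UScal c)) u.
Proof. by rewrite /uscale upiM upi_repr. Qed.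
Fact uscaleA a b u : uscale a (uscale b u) = uscale (a * b) u.
Proof.
by rewrite !uscaleE umulA -upiM; congr umul; apply/esym/upiP/ueq_scalM.
Qed.
Fact uscale1 : left_id 1 uscale.
Proof. by move=> u; rewrite uscaleE umul1. Qed.
Fact uscaleDr : right_distributive uscale +%R.
Proof. by move=> c u v; rewrite !uscaleE umulDr. Qed.
Fact uscaleDl u : {morph uscale^~ u : a b / a + b}.
Proof.
move=> a b; rewrite !uscaleE -[RHS]umulDl; congr umul.
by rewrite -upiD; apply/upiP/ueq_scalD.
Qed.
HB.instance Definition _ :=
  GRing.Zmodule_isLmodule.Build K Uenv uscaleA uscale1 uscaleDr uscaleDl.

Fact umul_bilin : bilin (umul : Uenv -> Uenv -> Uenv).
Proof.
split=> u c v w /=.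
  have -> : umul u (c *: v + w) = umul u (c *: v) + umul u w by exact: umulDr.
  congr (_ + _); rewrite /GRing.scale /= !uscaleE !umulA; congr umul.
  move: u; elim/uind=> s; rewrite -!upiM; exact/esym/upiP/ueq_scalC.
have -> : umul (c *: v + w) u = umul (c *: v) u + umul w u by exact: umulDl.
by congr (_ + _); rewrite /GRing.scale /= !uscaleE umulA.
Qed.
HB.instance Definition _ := isBareAlgebra.Build K Uenv umulA umul_bilin.
HB.instance Definition _ := hasIdentity.Build K Uenv umul1 umulr1.

Definition uinj (x : g) : Uenv := upi (UGen x).

Lemma upiDE s t : upi (UAdd s t) = upi s + upi t. Proof. exact: upiD. Qed.
Lemma upiME s t : upi (UMul s t) = upi s ** upi t. Proof. exact: upiM. Qed.
Lemma upiSE c : upi (UScal c) = c *: bone.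
Proof. by rewrite /GRing.scale /= uscaleE umulr1. Qed.

Lemma uinj_linear : linear uinj.
Proof.
move=> c x y; have -> : uinj (c *: x + y) = upi (UAdd (UGen (c *: x)) (UGen y)).
  exact/upiP/ueq_genD.
rewrite upiDE; congr (_ + _).
have -> : upi (UGen (c *: x)) = upi (UMul (UScal c) (UGen x)) by apply/upiP/ueq_genZ.
by rewrite upiME upiSE bmulZl bmul1.
Qed.
Lemma uinj_brk x y : uinj (brk x y) = uinj x ** uinj y - uinj y ** uinj x.
Proof.
by apply/eqP; rewrite eq_sym subr_eq -!upiME -upiDE;
  apply/eqP/esym/upiP/ueq_brk.
Qed.

Lemma Uenv_ind (P : Uenv -> Prop) :
  P bone -> (forall x, P (uinj x)) -> (forall c u, P u -> P (c *: u)) ->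
  (forall u v, P u -> P v -> P (u + v)) ->
  (forall u v, P u -> P v -> P (u ** v)) -> forall u, P u.
Proof.
move=> P1 Px PZ PD PM; elim/uind; elim=> [c|x|s ihs t iht|s ihs t iht].
- by rewrite upiSE; apply: PZ.
- exact: Px.
- by rewrite upiDE; apply: PD.
- by rewrite upiME; apply: PM.
Qed.

Section Lift.
Variables (W : unitalAlgType K) (f : g -> W).

Fixpoint uev (s : uexpr) : W := match s with
  | UScal c => c *: bone
  | UGen x => f x
  | UAdd s t => uev s + uev t
  | UMul s t => uev s ** uev t
  end.
Definition Ulift (u : Uenv) : W := uev (repr u).

Hypothesis fl : linear f.
Hypothesis fb : forall x y, f (brk x y) = f x ** f y - f y ** f x.

Lemma uev_eq s t : ueq s t -> uev s = uev t.
Proof.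
elim=> {s t} //=.
- by move=> s t r _ -> _ ->.
- by move=> s s' t t' _ -> _ ->.
- by move=> s s' t t' _ -> _ ->.
- by move=> *; rewrite addrA.
- by move=> *; rewrite addrC.
- by move=> *; rewrite scale0r add0r.
- by move=> s; rewrite bmulZl bmul1 scaleN1r addNr scale0r.
- by move=> *; rewrite bmulA.
- by move=> *; rewrite scale1r bmul1.
- by move=> *; rewrite bmulDl.
- by move=> *; rewrite bmulDr.
- by move=> *; rewrite bmulZl bmulZr bmul1 bmulr1.
- by move=> *; rewrite scalerDl.
- by move=> *; rewrite bmulZl bmul1 scalerA.
- by move=> *; rewrite (linear_D fl).
- by move=> *; rewrite (linear_Z fl) bmulZl bmul1.
- by move=> *; rewrite fb subrK.
Qed.
Lemma Ulift_upi s : Ulift (upi s) = uev s.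
Proof. exact/uev_eq/repr_upi. Qed.
Lemma Ulift_hom : unital_alg_hom Ulift.
Proof.
split=> [c||].
- elim/uind=> s; elim/uind=> t.
  have -> : c *: upi s = upi (UMul (UScal c) s) by rewrite upiME upiSE bmulZl bmul1.
  by rewrite -upiDE !Ulift_upi /= bmulZl bmul1.
- by rewrite -[LHS]/(Ulift (upi (UScal 1))) Ulift_upi /= scale1r.
- by elim/uind=> s; elim/uind=> t; rewrite -upiME !Ulift_upi.
Qed.
Lemma Ulift_inj x : Ulift (uinj x) = f x.
Proof. exact: Ulift_upi. Qed.
End Lift.

Section Derivation.
Variable d : g -> g.

Fixpoint uderiv_expr (s : uexpr) : Uenv := match s with
  | UScal _ => 0
  | UGen x => uinj (d x)
  | UAdd s t => uderiv_expr s + uderiv_expr t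
  | UMul s t => uderiv_expr s ** upi t + upi s ** uderiv_expr t
  end.
Definition Uder (u : Uenv) : Uenv := uderiv_expr (repr u).

Hypothesis dl : linear d.
Hypothesis db : forall x y, d (brk x y) = brk (d x) y + brk x (d y).

Lemma uderiv_eq s t : ueq s t -> uderiv_expr s = uderiv_expr t.
Proof.
elim=> {s t} //=.
- by move=> s t r _ -> _ ->.
- by move=> s s' t t' _ -> _ ->.
- by move=> s s' t t' /upiP-> -> /upiP-> ->.
- by move=> *; rewrite addrA.
- by move=> *; rewrite addrC.
- by move=> *; rewrite add0r.
- by move=> s; rewrite upiSE bmulZl bmul1 bmul0l add0r scaleN1r addNr.
- by move=> *; rewrite !upiME bmulDr bmulDl !bmulA !addrA.
- by move=> *; rewrite upiSE bmul0l add0r scale1r bmul1.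
- move=> s t r; rewrite upiDE !bmulDl !addrA; congr (_ + _).
  by rewrite -!addrA; congr (_ + _); rewrite addrC.
- move=> s t r; rewrite upiDE !bmulDr !addrA; congr (_ + _).
  by rewrite -!addrA; congr (_ + _); rewrite addrC.
- by move=> *; rewrite upiSE bmulZl bmulZr bmul1 bmulr1 bmul0l bmul0r add0r addr0.
- by move=> *; rewrite addr0.
- by move=> *; rewrite bmul0l bmul0r addr0.
- by move=> *; rewrite (linear_D dl) (linear_D uinj_linear).
- move=> *; rewrite (linear_Z dl) (linear_Z uinj_linear) upiSE.
  by rewrite bmul0l add0r bmulZl bmul1.
- move=> x y; rewrite db (linear_D uinj_linear) !uinj_brk.
  rewrite [X in X + _ = _]addrACA -opprD.
  by rewrite [uinj (d y) ** _ + _]addrC subrK.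
Qed.
Lemma Uder_upi s : Uder (upi s) = uderiv_expr s.
Proof. exact/uderiv_eq/repr_upi. Qed.
Lemma Uder_linear : linear Uder.
Proof.
move=> c; elim/uind=> s; elim/uind=> t.
have -> : c *: upi s = upi (UMul (UScal c) s) by rewrite upiME upiSE bmulZl bmul1.
by rewrite -upiDE !Uder_upi /= bmul0l add0r upiSE bmulZl bmul1.
Qed.
Lemma Uder_inj x : Uder (uinj x) = uinj (d x). Proof. exact: Uder_upi. Qed.
Lemma Uder1 : Uder bone = 0. Proof. exact: (Uder_upi (UScal 1)). Qed.
Lemma UderM u v : Uder (u ** v) = Uder u ** v + u ** Uder v.
Proof.
by move: u v; elim/uind=> s; elim/uind=> t; rewrite -upiME !Uder_upi.
Qed.
End Derivation.

Section Representation.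
Variables (W : lmodType K) (rho : g -> W -> W).

Fixpoint urep_expr (s : uexpr) (w : W) : W := match s with
  | UScal c => c *: w
  | UGen x => rho x w
  | UAdd s t => urep_expr s w + urep_expr t w
  | UMul s t => urep_expr s (urep_expr t w)
  end.
Definition Urep (u : Uenv) (w : W) : W := urep_expr (repr u) w.

Hypothesis rho_bilin : bilin rho.
Hypothesis rho_brk : forall x y w, rho (brk x y) w = rho x (rho y w) - rho y (rho x w).

Lemma urep_linear s : linear (urep_expr s).
Proof.
elim: s => [c|x|s ihs t iht|s ihs t iht] b v w /=.
- by rewrite scalerDr !scalerA mulrC.
- exact: rho_bilin.1.
- by rewrite ihs iht scalerDr addrACA.
- by rewrite iht ihs.
Qed.
Lemma urep_eq s t : ueq s t -> forall w, urep_expr s w = urep_expr t w.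
Proof.
elim=> {s t} //=.
- by move=> s t r _ h1 _ h2 w; rewrite h1.
- by move=> s s' t t' _ h1 _ h2 w; rewrite h1 h2.
- by move=> s s' t t' _ h1 _ h2 w; rewrite h1 h2.
- by move=> *; rewrite addrA.
- by move=> *; rewrite addrC.
- by move=> *; rewrite scale0r add0r.
- by move=> *; rewrite scaleN1r addNr scale0r.
- by move=> *; rewrite scale1r.
- by move=> s t r w; rewrite (linear_D (urep_linear s)).
- by move=> c s w; rewrite (linear_Z (urep_linear s)).
- by move=> *; rewrite scalerDl.
- by move=> *; rewrite scalerA.
- by move=> x y w; rewrite (linear_D (rho_bilin.2 w)).
- by move=> c x w; rewrite (linear_Z (rho_bilin.2 w)).
- by move=> *; rewrite rho_brk subrK.
Qed.
Lemma Urep_upi s w : Urep (upi s) w = urep_expr s w.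
Proof. exact/urep_eq/repr_upi. Qed.
Lemma Urep_bilin : bilin Urep.
Proof.
split=> [u|w c]; first exact: urep_linear.
elim/uind=> s; elim/uind=> t.
have -> : c *: upi s = upi (UMul (UScal c) s) by rewrite upiME upiSE bmulZl bmul1.
by rewrite -upiDE !Urep_upi.
Qed.
Lemma Urep_inj x w : Urep (uinj x) w = rho x w. Proof. exact: Urep_upi. Qed.
Lemma Urep1 w : Urep bone w = w.
Proof. by rewrite -[LHS]/(Urep (upi (UScal 1)) w) Urep_upi /= scale1r. Qed.
Lemma UrepM u v w : Urep (u ** v) w = Urep u (Urep v w).
Proof.
by move: u v; elim/uind=> s; elim/uind=> t; rewrite -upiME !Urep_upi.
Qed.
End Representation.
End Enveloping.
Arguments Uenv {K} g.

Section Tensor.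
Variables (K : fieldType) (U V : lmodType K).

(* Nonempty formal sums of pure tensors; zero is the tensor of 0 and 0. *)
Inductive texpr : Type := TPure of U & V | TAdd of texpr & texpr.
HB.instance Definition _ := gen_eqMixin texpr.
HB.instance Definition _ := gen_choiceMixin texpr.

Inductive teq : texpr -> texpr -> Prop :=
  | teq_refl s : teq s s
  | teq_sym s t : teq s t -> teq t s
  | teq_trans s t r : teq s t -> teq t r -> teq s r
  | teq_add s s' t t' : teq s s' -> teq t t' -> teq (TAdd s t) (TAdd s' t')
  | teq_addA s t r : teq (TAdd s (TAdd t r)) (TAdd (TAdd s t) r)
  | teq_addC s t : teq (TAdd s t) (TAdd t s)
  | teq_Dl u u' v : teq (TPure (u + u') v) (TAdd (TPure u v) (TPure u' v))
  | teq_Dr u v v' : teq (TPure u (v + v')) (TAdd (TPure u v) (TPure u v'))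
  | teq_Z c u v : teq (TPure (c *: u) v) (TPure u (c *: v)).

Definition teqb s t := `[< teq s t >].
Lemma teqb_equiv : equiv_class_of teqb.
Proof.
split=> [s|s t|t s r]; first exact/asboolP/teq_refl.
  by apply/asboolP/asboolP; apply: teq_sym.
by move=> /asboolP st /asboolP tr; apply/asboolP/(teq_trans st).
Qed.
Canonical teqb_equiv_rel := EquivRelPack teqb_equiv.

Definition tensor := {eq_quot teqb}.
HB.instance Definition _ := Choice.on tensor.
HB.instance Definition _ := EqQuotient.on tensor.

Definition tpi (s : texpr) : tensor := \pi_tensor s.

Lemma tpiP s t : tpi s = tpi t <-> teq s t.
Proof.
by rewrite /tpi; split=> [/eqmodP/asboolP|h]; last exact/eqmodP/asboolP.
Qed.
Lemma tpi_repr u : tpi (repr u) = u. Proof. exact: reprK. Qed.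
Lemma repr_tpi s : teq (repr (tpi s)) s. Proof. by apply/tpiP;
  rewrite tpi_repr. Qed.

Fixpoint tscale_expr c (s : texpr) : texpr := match s with
  | TPure u v => TPure (c *: u) v
  | TAdd s t => TAdd (tscale_expr c s) (tscale_expr c t)
  end.
Definition tadd (x y : tensor) := tpi (TAdd (repr x) (repr y)).
Definition tscale c (x : tensor) := tpi (tscale_expr c (repr x)).
Definition topp (x : tensor) := tscale (-1) x.
Definition tzero : tensor := tpi (TPure 0 0).
Definition tens (u : U) (v : V) : tensor := tpi (TPure u v).

Lemma tscale_eq c s t : teq s t -> teq (tscale_expr c s) (tscale_expr c t).
Proof.
elim=> {s t} /=.
- by move=> *; apply: teq_refl.
- by move=> *; apply: teq_sym.
- by move=> s t r _ h _; apply: teq_trans.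
- by move=> *; apply: teq_add.
- by move=> *; apply: teq_addA.
- by move=> *; apply: teq_addC.
- by move=> *; rewrite scalerDr; apply: teq_Dl.
- by move=> *; apply: teq_Dr.
- by move=> *; rewrite scalerA mulrC -scalerA; apply: teq_Z.
Qed.
Lemma tpiD s t : tpi (TAdd s t) = tadd (tpi s) (tpi t).
Proof. by apply/tpiP; apply: teq_add; apply: teq_sym; apply: repr_tpi. Qed.
Lemma tpiZ c s : tscale c (tpi s) = tpi (tscale_expr c s).
Proof. exact/tpiP/tscale_eq/repr_tpi. Qed.
Lemma tind (P : tensor -> Prop) : (forall s, P (tpi s)) -> forall u, P u.
Proof. by move=> h u; rewrite -(tpi_repr u). Qed.

Fact taddA : associative tadd.
Proof.
by elim/tind=> s; elim/tind=> t; elim/tind=> r; rewrite -!tpiD;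
  apply/tpiP/teq_addA.
Qed.
Fact taddC : commutative tadd.
Proof.
by elim/tind=> s; elim/tind=> t; rewrite -!tpiD; apply/tpiP/teq_addC.
Qed.
Fact tpure0l v : tens 0 v = tzero.
Proof.
by apply/tpiP; rewrite -{1}(scale0r (0 : U)) -[X in TPure 0 X](scale0r v);
  apply: teq_Z.
Qed.
Fact taddP u u' v : tadd (tens u v) (tens u' v) = tens (u + u') v.
Proof. by rewrite -tpiD; apply/esym/tpiP/teq_Dl. Qed.
Fact tadd0 : left_id tzero tadd.
Proof.
elim/tind; elim=> [u v|s ihs t iht]; last by rewrite tpiD taddA ihs.
by rewrite -(tpure0l v) taddP add0r.
Qed.
Fact taddN : left_inverse tzero topp tadd.
Proof.
rewrite /topp; elim/tind; elim=> [u v|s ihs t iht].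
  by rewrite tpiZ /= [LHS]taddP scaleN1r addNr tpure0l.
rewrite tpiZ /= !tpiD -!tpiZ.
rewrite taddA -(taddA (tscale _ _)) (taddC _ (tpi s)) !taddA ihs tadd0;
  exact: iht.
Qed.
HB.instance Definition _ := GRing.isZmodule.Build tensor taddA taddC tadd0 taddN.

Fact tscaleA a b x : tscale a (tscale b x) = tscale (a * b) x.
Proof.
move: x; elim/tind=> s; rewrite !tpiZ; congr tpi.
by elim: s => [u v|s ihs t iht] /=; rewrite ?scalerA // ihs iht.
Qed.
Fact tscale1 : left_id 1 tscale.
Proof.
elim/tind=> s; rewrite !tpiZ; congr tpi.
by elim: s => [u v|s ihs t iht] /=; rewrite ?scale1r // ihs iht.
Qed.
Fact tscaleDr : right_distributive tscale +%R.
Proof.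
move=> c; elim/tind=> s; elim/tind=> t.
by rewrite -[_ + _]tpiD !tpiZ -[RHS]tpiD.
Qed.
Fact tscaleDl x : {morph tscale^~ x : a b / a + b}.
Proof.
move: x; elim/tind; elim=> [u v|s ihs t iht] a b; rewrite !tpiZ /=.
  by rewrite [RHS]taddP scalerDl.
by rewrite !tpiD -!tpiZ ihs iht -!/(_ + _) addrACA.
Qed.
HB.instance Definition _ :=
  GRing.Zmodule_isLmodule.Build K tensor tscaleA tscale1 tscaleDr tscaleDl.

Lemma tpiDE s t : tpi (TAdd s t) = tpi s + tpi t. Proof. exact: tpiD. Qed.

Lemma tens_bilin : bilin tens.
Proof.
have ZE c s : c *: tpi s = tpi (tscale_expr c s) by exact: tpiZ.
split=> [u c v w|v c u w]; rewrite ?ZE /=.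
  rewrite -tpiDE; apply/tpiP; apply: teq_trans (teq_Dr _ _ _) _.
  by apply: teq_add (teq_refl _); apply/teq_sym/teq_Z.
by rewrite -tpiDE; apply/tpiP/teq_Dl.
Qed.

Lemma tensor_ind (P : tensor -> Prop) :
  (forall u v, P (tens u v)) -> (forall x y, P x -> P y -> P (x + y)) ->
  forall x, P x.
Proof.
move=> Pt PD; elim/tind; elim=> [u v|s ihs t iht]; first exact: Pt.
by rewrite tpiDE; apply: PD.
Qed.

Section Lift.
Variables (W : lmodType K) (f : U -> V -> W).
Fixpoint tev (s : texpr) : W := match s with
  | TPure u v => f u v
  | TAdd s t => tev s + tev t
  end.
Definition tlift (x : tensor) : W := tev (repr x).
Hypothesis fb : bilin f.

Lemma tev_eq s t : teq s t -> tev s = tev t.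
Proof.
elim=> {s t} //=.
- by move=> s t r _ -> _ ->.
- by move=> s s' t t' _ -> _ ->.
- by move=> *; rewrite addrA.
- by move=> *; rewrite addrC.
- by move=> u u' v; rewrite (linear_D (fb.2 v)).
- by move=> u v v'; rewrite (linear_D (fb.1 u)).
- by move=> c u v; rewrite (linear_Z (fb.2 v)) (linear_Z (fb.1 u)).
Qed.
Lemma tlift_tpi s : tlift (tpi s) = tev s.
Proof. exact/tev_eq/repr_tpi. Qed.
Lemma tlift_tens u v : tlift (tens u v) = f u v.
Proof. exact: tlift_tpi. Qed.
Lemma tliftD : {morph tlift : x y / x + y}.
Proof. by elim/tind=> s; elim/tind=> t; rewrite -tpiDE !tlift_tpi. Qed.
Lemma tlift_linear : linear tlift.
Proof.
move=> c x y; rewrite tliftD; congr (_ + _).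
elim/tensor_ind: x => [u v|x x' ih ih'];
  last by rewrite scalerDr !tliftD ih ih' scalerDr.
by rewrite -(linear_Z (tens_bilin.2 v)) !tlift_tens (linear_Z (fb.2 v)).
Qed.
End Lift.
End Tensor.

Section TensorAlgebra.
Variables (K : fieldType) (U V : unitalAlgType K).

Fact tens_mul_bilin (u : U) (v : V) :
  bilin (fun u' v' => tens (u ** u') (v ** v')).
Proof.
split=> [u' c v1 v2|v' c u1 u2] /=; rewrite bmulDr bmulZr.
  exact: (tens_bilin _ _).1.
exact: ((tens_bilin _ _).2 _).
Qed.

Definition tmul_pure (u : U) (v : V) (y : tensor U V) : tensor U V :=
  tlift (fun u' v' => tens (u ** u') (v ** v')) y.

Fact tmul_pure_bilin y : bilin (fun u v => tmul_pure u v y).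
Proof.
have TB := tens_bilin U V.
have PT u v u' v' : tmul_pure u v (tens u' v') = tens (u ** u') (v ** v').
  exact/tlift_tens/tens_mul_bilin.
have PD u v : {morph tmul_pure u v : x y / x + y} by exact/tliftD/tens_mul_bilin.
split=> [u c v1 v2|v c u1 u2]; elim/tensor_ind: y => [u' v'|x y ihx ihy].
- by rewrite !PT bmulDl bmulZl TB.1.
- by rewrite !PD ihx ihy scalerDr addrACA.
- by rewrite !PT bmulDl bmulZl (TB.2 _).
- by rewrite !PD ihx ihy scalerDr addrACA.
Qed.

Definition tmul (x y : tensor U V) : tensor U V :=
  tlift (fun u v => tmul_pure u v y) x.

Lemma tmul_tens u v u' v' : tmul (tens u v) (tens u' v') = tens (u ** u') (v ** v').
Proof.
by rewrite /tmul tlift_tens; [rewrite /tmul_pure tlift_tens //;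
  exact: tens_mul_bilin|exact: tmul_pure_bilin].
Qed.

Fact tmul_bilin : bilin tmul.
Proof.
split=> [x c y y'|y]; last exact/tlift_linear/tmul_pure_bilin.
have TP u v : linear (tmul_pure u v) by exact/tlift_linear/tens_mul_bilin.
elim/tensor_ind: x => [u v|x x' ih ih']; rewrite /tmul.
  by rewrite !(tlift_tens (tmul_pure_bilin _)) TP.
by rewrite !(tliftD (tmul_pure_bilin _)) -!/(tmul _ _) ih ih' scalerDr addrACA.
Qed.
Fact tmulDl x x' y : tmul (x + x') y = tmul x y + tmul x' y.
Proof. exact: (linear_D (tmul_bilin.2 y)). Qed.
Fact tmulDr x y y' : tmul x (y + y') = tmul x y + tmul x y'.
Proof. exact: (linear_D (tmul_bilin.1 x)). Qed.
Fact tmulA : associative tmul.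
Proof.
elim/tensor_ind=> [u v|x x' ihx ihx'] y z; last by rewrite !tmulDl ihx ihx'.
elim/tensor_ind: y => [u' v'|y y' ihy ihy'];
  last by rewrite tmulDl !tmulDr tmulDl ihy ihy'.
elim/tensor_ind: z => [u'' v''|z z' ihz ihz']; last by rewrite !tmulDr ihz ihz'.
by rewrite !tmul_tens !bmulA.
Qed.
Definition tone : tensor U V := tens bone bone.
Fact tmul1 : left_id tone tmul.
Proof.
elim/tensor_ind=> [u v|x y ihx ihy]; first by rewrite tmul_tens !bmul1.
by rewrite tmulDr ihx ihy.
Qed.
Fact tmulr1 : right_id tone tmul.
Proof.
elim/tensor_ind=> [u v|x y ihx ihy]; first by rewrite tmul_tens !bmulr1.
by rewrite tmulDl ihx ihy.
Qed.
HB.instance Definition _ := isBareAlgebra.Build K (tensor U V) tmulA tmul_bilin.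
HB.instance Definition _ := hasIdentity.Build K (tensor U V) tmul1 tmulr1.

Lemma tensM u v u' v' :
  (tens u v : tensor U V) ** (tens u' v' : tensor U V) = tens (u ** u') (v ** v').
Proof. exact: tmul_tens. Qed.
End TensorAlgebra.

Fact add_cross (V : zmodType) (p q r s e f : V) :
  (p - q) + (r - s) = (p + e + (f + r)) - (q + f + (e + s)).
Proof.
rewrite [f + r]addrC [e + s]addrC [X in _ = X - _]addrACA [X in _ = _ - X]addrACA.
by rewrite [f + e]addrC opprD [RHS]addrACA subrr addr0 opprD addrACA.
Qed.

Section Coproduct.
Variables (K : fieldType) (g : lieAlgType K).
Local Notation U := (Uenv g).

Definition Udelta : U -> tensor U U :=
  Ulift (fun x => tens (uinj x) bone + tens bone (uinj x)).

Fact Udelta_gen_linear :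
  linear (fun x : g => tens (uinj x) (bone : U) + tens (bone : U) (uinj x)).
Proof.
move=> c x y /=; rewrite (@uinj_linear _ g c x y).
by rewrite ((tens_bilin U U).2 _) (tens_bilin U U).1 scalerDr addrACA.
Qed.
Fact Udelta_gen_brk (x y : g) :
  let d z : tensor U U := tens (uinj z) bone + tens bone (uinj z) in
  d (brk x y) = d x ** d y - d y ** d x.
Proof.
have TB := tens_bilin U U.
rewrite /= !(bmulDl, bmulDr) !tensM !bmul1 !bmulr1 uinj_brk.
rewrite (linear_D (TB.2 _)) (linear_N (TB.2 _)) (linear_D (TB.1 _)) (linear_N (TB.1 _)).
exact: add_cross.
Qed.

Lemma Udelta_hom : unital_alg_hom Udelta.
Proof. exact: (Ulift_hom Udelta_gen_linear Udelta_gen_brk). Qed.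
Lemma Udelta_inj x : Udelta (uinj x) = tens (uinj x) bone + tens bone (uinj x).
Proof. exact: (Ulift_inj Udelta_gen_linear Udelta_gen_brk). Qed.
End Coproduct.

Definition lie_of (K : fieldType) (A : bareAlgType K) : Type := A.
Section LieOf.
Variables (K : fieldType) (A : bareAlgType K).
HB.instance Definition _ := GRing.Lmodule.on (lie_of A).
Definition commutator (a b : lie_of A) : lie_of A :=
  ((a : A) ** (b : A) - (b : A) ** (a : A) : A).
Fact commutator_bilin : bilin commutator.
Proof.
split=> [a c x y|b c x y]; rewrite /commutator bmulDl bmulDr bmulZl bmulZr.
  by rewrite scalerBr opprD addrACA.
by rewrite scalerBr opprD addrACA.
Qed.
Fact commutatorxx a : commutator a a = 0. Proof. exact: subrr. Qed.
Fact commutator_jacobi x y z :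
  commutator x (commutator y z) + commutator y (commutator z x)
    + commutator z (commutator x y) = 0.
Proof.
have E (a b c : A) : a ** (b ** c - c ** b) - (b ** c - c ** b) ** a
    = (a ** b ** c - b ** c ** a) + (c ** b ** a - a ** c ** b).
  rewrite bmulBr bmulBl !bmulA opprB [X in _ + X]addrC addrACA.
  by rewrite [- (a ** c ** b) + _]addrC.
have tel (P Q R p q r : A) :
    (P - Q + (p - q)) + (Q - R + (q - r)) + (R - P + (r - p)) = 0.
  have t2 (a b c : A) : a - b + (b - c) + (c - a) = 0.
    by rewrite !addrA !subrK subrr.
  by rewrite [X in X + _ = _]addrACA [LHS]addrACA !t2 addr0.
rewrite /commutator !E; exact: tel.
Qed.
HB.instance Definition _ := isLieAlgebra.Build K (lie_of A)
  commutator_bilin commutatorxx commutator_jacobi.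
End LieOf.

(* [bxl] and [bxr] are the left and right actions of B on A. *)
Record bare_xmod (K : fieldType) (A B : bareAlgType K) := BareXmod {
  bxd : A -> B;
  bxl : B -> A -> A;
  bxr : A -> B -> A;
  bxd_linear : linear bxd;
  bxdM : {morph bxd : a a' / a ** a'};
  bxl_bilin : bilin bxl;
  bxr_bilin : bilin bxr;
  bxlM : forall b b' a, bxl (b ** b') a = bxl b (bxl b' a);
  bxrM : forall a b b', bxr a (b ** b') = bxr (bxr a b) b';
  bxl_mul : forall b a a', bxl b (a ** a') = bxl b a ** a';
  bxr_mul : forall a a' b, bxr (a ** a') b = a ** bxr a' b;
  bxlr : forall b a b', bxl b (bxr a b') = bxr (bxl b a) b';
  bxr_mul_bxl : forall a b b' a', bxr a b ** bxl b' a' = a ** bxl (b ** b') a';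
  bx_middle : forall a b b' a', a ** bxl (b ** b') a' = bxr a (b ** b') ** a';
  bxd_bxl : forall b a, bxd (bxl b a) = b ** bxd a;
  bxd_bxr : forall a b, bxd (bxr a b) = bxd a ** b;
  bxl_bxd : forall a' a, bxl (bxd a') a = a' ** a;
  bxr_bxd : forall a a', bxr a (bxd a') = a ** a'
}.

Definition unital_bare_xmod (K : fieldType) (A : bareAlgType K)
    (B : unitalAlgType K) (X : bare_xmod A B) :=
  (forall a, bxl X bone a = a) /\ (forall a, bxr X a bone = a).

Record lie_xmod (K : fieldType) (g h : lieAlgType K) := LieXmod {
  lxd : g -> h;
  lxact : h -> g -> g;
  lxd_linear : linear lxd;
  lxd_brk : {morph lxd : a a' / brk a a'};
  lxact_bilin : bilin lxact;
  lxact_brk : forall x y a,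
    lxact (brk x y) a = lxact x (lxact y a) - lxact y (lxact x a);
  lxact_der : forall x a a',
    lxact x (brk a a') = brk (lxact x a) a' + brk a (lxact x a');
  lxd_act : forall x a, lxd (lxact x a) = brk x (lxd a);
  lx_peiffer : forall a a', lxact (lxd a) a' = brk a a'
}.

Local Open Scope group_scope.
Record group_xmod := GroupXmod {
  gx_top : groupType;
  gx_base : groupType;
  gx_bd : gx_top -> gx_base;
  gx_act : gx_base -> gx_top -> gx_top;
  gx_bdM : {morph gx_bd : x y / x * y};
  gx_act1 : forall x, gx_act 1 x = x;
  gx_actM : forall b b' x, gx_act (b * b') x = gx_act b (gx_act b' x);
  gx_act_mul : forall b, {morph gx_act b : x y / x * y};
  gx_bd_act : forall b x, gx_bd (gx_act b x) = b * gx_bd x * b^-1;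
  gx_peiffer : forall x y, gx_act (gx_bd x) y = x * y * x^-1
}.

Record group_xmod_map (X Y : group_xmod) := GroupXmodMap {
  gxm_top : gx_top X -> gx_top Y;
  gxm_base : gx_base X -> gx_base Y;
  gxm_topM : {morph gxm_top : x y / x * y};
  gxm_baseM : {morph gxm_base : b c / b * c};
  gxm_bd : forall x, gx_bd (gxm_top x) = gxm_base (gx_bd x);
  gxm_act : forall b x, gxm_top (gx_act b x) = gx_act (gxm_base b) (gxm_top x)
}.
Local Close Scope group_scope.

Section LieXmodOf.
Variables (K : fieldType) (A B : bareAlgType K) (X : bare_xmod A B).

Definition lie_bd (a : lie_of A) : lie_of B := bxd X a.
Definition lie_act (b : lie_of B) (a : lie_of A) : lie_of A :=
  (bxl X b a - bxr X a b : A).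

Fact lie_bd_linear : linear lie_bd. Proof. exact: (bxd_linear X). Qed.
Fact lie_bd_brk : {morph lie_bd : a a' / brk a a'}.
Proof.
have dl := @bxd_linear _ _ _ X.
move=> a a'; rewrite /lie_bd /brk /= /commutator.
by rewrite [LHS](linear_D dl) (linear_N dl) !bxdM.
Qed.
Fact lie_act_bilin : bilin lie_act.
Proof.
split=> [b c x y|a c x y]; rewrite /lie_act.
  by rewrite (bxl_bilin X).1 ((bxr_bilin X).2 b) scalerBr opprD addrACA.
by rewrite ((bxl_bilin X).2 a) (bxr_bilin X).1 scalerBr opprD addrACA.
Qed.
Fact sub_sub_sub (V : zmodType) (a b c d : V) : a - b - (c - d) = (a + d) - (b + c).
Proof. by rewrite opprB addrACA -opprD. Qed.
Fact bxlB b : {morph bxl X b : u v / u - v}.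
Proof.
by move=> u v /=; rewrite (linear_D ((bxl_bilin X).1 b)) (linear_N ((bxl_bilin X).1 b)).
Qed.
Fact bxrB b u v : bxr X (u - v) b = bxr X u b - bxr X v b.
Proof.
by rewrite [LHS](linear_D ((bxr_bilin X).2 b)) [bxr X (- v) b](linear_N ((bxr_bilin X).2 b)).
Qed.
Fact bxl_subl b b' a : bxl X (b - b') a = bxl X b a - bxl X b' a.
Proof.
by rewrite [LHS](linear_D ((bxl_bilin X).2 a)) [bxl X (- b') a](linear_N ((bxl_bilin X).2 a)).
Qed.
Fact bxr_subr a b b' : bxr X a (b - b') = bxr X a b - bxr X a b'.
Proof.
by rewrite (linear_D ((bxr_bilin X).1 a)) (linear_N ((bxr_bilin X).1 a)).
Qed.
Fact bxr_mull a b a' : bxr X a b ** a' = a ** bxl X b a'.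
Proof. by rewrite -!(bxl_bxd X) bxd_bxr bxlM. Qed.

Fact lie_act_brk x y a :
  lie_act (brk x y) a = lie_act x (lie_act y a) - lie_act y (lie_act x a).
Proof.
rewrite /lie_act /brk /= /commutator bxl_subl bxr_subr !bxlB !bxrB !bxlM !bxrM !bxlr.
rewrite [LHS]sub_sub_sub [RHS](congr2 (fun u v => u - v) (sub_sub_sub _ _ _ _) (sub_sub_sub _ _ _ _)).
by rewrite [X in _ = _ - (_ - X)]addrC opprB addrA subrK.
Qed.
Fact lie_act_der x a a' :
  lie_act x (brk a a') = brk (lie_act x a) a' + brk a (lie_act x a').
Proof.
rewrite /lie_act /brk /= /commutator bxlB bxrB !bxl_mul !bxr_mul !bmulBl !bmulBr !bxr_mull.
rewrite [LHS]sub_sub_sub [RHS](congr2 (fun u v => u + v) (sub_sub_sub _ _ _ _) (sub_sub_sub _ _ _ _)).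
by rewrite [RHS]addrA subrK [X in _ = _ - X]addrC.
Qed.
Fact lie_bd_act x a : lie_bd (lie_act x a) = brk x (lie_bd a).
Proof.
have dl := @bxd_linear _ _ _ X.
by rewrite /lie_bd /lie_act [LHS](linear_D dl) (linear_N dl) bxd_bxl bxd_bxr.
Qed.
Fact lie_bd_peiffer a a' : lie_act (lie_bd a) a' = brk a a'.
Proof. by rewrite /lie_act bxl_bxd bxr_bxd. Qed.

Definition lie_xmod_of : lie_xmod (lie_of A) (lie_of B) :=
  LieXmod lie_bd_linear lie_bd_brk lie_act_bilin lie_act_brk lie_act_der
    lie_bd_act lie_bd_peiffer.
End LieXmodOf.

Section Convolution.
Variable V : zmodType.
Implicit Type F : nat -> nat -> V.

Definition csum n F : V := \sum_(i < n.+1) F i (n - i)%N.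

Lemma eq_csum n F G : (forall i j, F i j = G i j) -> csum n F = csum n G.
Proof. by move=> FG; apply: eq_bigr. Qed.
Lemma csumD n F G : csum n (fun i j => F i j + G i j) = csum n F + csum n G.
Proof. exact: big_split. Qed.
Lemma csumC n F : csum n F = csum n (fun i j => F j i).
Proof.
rewrite /csum (reindex_inj rev_ord_inj) /=; apply: eq_bigr => i _.
by rewrite subSS subKn // -ltnS.
Qed.
Lemma csumA n (F : nat -> nat -> nat -> V) :
  csum n (fun i k => csum i (fun p q => F p q k)) =
  csum n (fun p j => csum j (fun q k => F p q k)).
Proof.
rewrite /csum.
transitivity (\sum_(i < n.+1) \sum_(p < n.+1 | (p <= i)%N) F p (i - p)%N (n - i)%N).
  apply: eq_bigr => i _; rewrite (big_ord_narrow_leq (leq_ord i));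
    exact: eq_bigr.
rewrite (exchange_big_dep predT) //=; apply: eq_bigr => p _.
rewrite -(big_mkord (fun i => (p <= i)%N) (fun i => F p (i - p)%N (n - i)%N)).
rewrite -(big_mkord predT (fun q => F p q (n - p - q)%N)).
rewrite (big_cat_nat (n := p)) //=; last exact: ltnW.
rewrite big_nat_cond big1 ?add0r; last first.
  by move=> i /andP[/andP[_ ip] pi]; rewrite ltnNge pi in ip.
rewrite big_nat_cond (eq_bigl (fun i => (p <= i < n.+1)%N)); last first.
  by move=> i; case: (leqP p i); rewrite ?andbT ?andbF.
rewrite -big_nat -{1}[p : nat]add0n big_addn subSn; last exact: leq_ord.
apply: eq_big_nat => q _; rewrite addnK; congr F.
by rewrite -subnDA addnC.
Qed.
Lemma csumACA n (F : nat -> nat -> nat -> nat -> V) :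
  csum n (fun i j => csum i (fun p q => csum j (fun k l => F p q k l))) =
  csum n (fun i j => csum i (fun p k => csum j (fun q l => F p q k l))).
Proof.
rewrite (csumA _ (fun p q j => csum j (fun k l => F p q k l))).
rewrite (csumA _ (fun p k j => csum j (fun q l => F p q k l))).
apply: eq_csum => p j; rewrite -(csumA _ (fun q k l => F p q k l)).
rewrite -(csumA _ (fun k q l => F p q k l)).
by apply: eq_csum => i l; rewrite csumC.
Qed.
Lemma csum_recr n F : csum n F = \sum_(i < n) F i (n - i)%N + F n 0%N.
Proof. by rewrite /csum big_ord_recr /= subnn. Qed.
End Convolution.

Lemma linear_csum (K : fieldType) (U V : lmodType K) (f : U -> V) : linear f ->
  forall n F, f (csum n F) = csum n (fun i j => f (F i j)).
Proof. by move=> fl n F; rewrite /csum (linear_bigsum fl). Qed.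

(* Formal power series in h with constant term the identity; [scoef s n] is *)
(* the coefficient of h^n.                                                 *)
Record useries (K : fieldType) (W : unitalAlgType K) :=
  USeries { scoef :> nat -> W; scoef0 : scoef 0%N = bone }.

Section SeriesGroup.
Variables (K : fieldType) (W : unitalAlgType K).
Local Notation S := (useries W).

HB.instance Definition _ := gen_eqMixin S.
HB.instance Definition _ := gen_choiceMixin S.

Lemma useriesP (s t : S) : (forall n, s n = t n) -> s = t.
Proof.
case: s t => [s s0] [t t0] /= /funext st; case: t / st t0 => t0.
by congr USeries; apply: Prop_irrelevance.
Qed.

Fact smul_coef0 (s t : S) : csum 0 (fun i j => s i ** t j) = bone.
Proof. by rewrite /csum big_ord1 !scoef0 bmul1. Qed.
Definition smul (s t : S) : S :=
  @USeries K W (fun n => csum n (fun i j => s i ** t j)) (smul_coef0 s t).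

Definition sone : S := @USeries K W (fun n => if n is 0%N then bone else 0) erefl.

(* [sinv_rec s m n] is the coefficient of h^n of the inverse for n <= m. *)
Fixpoint sinv_rec (s : S) (m n : nat) : W :=
  if m is m'.+1 then
    if n == 0%N then bone else - \sum_(i < n) sinv_rec s m' i ** s (n - i)%N
  else bone.
Definition sinv (s : S) : S := @USeries K W (fun n => sinv_rec s n n) erefl.

Fact sinv_recE (s : S) m n : (n <= m)%N -> sinv_rec s m n = sinv s n.
Proof.
rewrite /sinv /=; elim/ltn_ind: n m => -[|n] ih [|m] //= le_nm.
congr (- _); apply: eq_bigr => i _; congr (_ ** _).
have le_in : (i <= n)%N by rewrite -ltnS.
by rewrite (ih i (ltn_ord i) m (leq_trans le_in le_nm)) (ih i (ltn_ord i) n le_in).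
Qed.

Fact smulA : associative smul.
Proof.
move=> s t r; apply: useriesP => n /=.
rewrite (eq_csum _ (G := fun i k => csum k (fun q l => s i ** t q ** r l)));
  last first.
  move=> i j; rewrite (linear_csum (bmul_bilin.1 _)).
  by apply: eq_csum => *; rewrite bmulA.
rewrite -csumA; apply: eq_csum => i k.
by rewrite [RHS](linear_csum (bmul_bilin.2 _)).
Qed.
Fact smul1 : left_id sone smul.
Proof.
move=> s; apply: useriesP => n /=.
rewrite /csum big_ord_recl /= bmul1 subn0 big1 ?addr0 // => i _.
by rewrite bmul0l.
Qed.
Fact smulr1 : right_id sone smul.
Proof.
move=> s; apply: useriesP => n /=.
rewrite csumC /csum big_ord_recl /= bmulr1 subn0 big1 ?addr0 // => i _.
by rewrite bmul0r.
Qed.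
Fact smulV : left_inverse sone sinv smul.
Proof.
move=> s; apply: useriesP => n; rewrite /= csum_recr scoef0 bmulr1.
case: n => [|n]; first by rewrite big_ord0 add0r.
rewrite [X in _ + X]/= [X in _ + X](_ : _ = - \sum_(i < n.+1) sinv s i ** s (n.+1 - i)%N).
  exact: subrr.
congr (- _); apply: eq_bigr => i _; rewrite sinv_recE //.
by rewrite -ltnS.
Qed.
Fact smulrV : right_inverse sone sinv smul.
Proof.
by move=> s; rewrite -[LHS]smul1 -{1}(smulV (sinv s)) -smulA (smulA (sinv s)) smulV smul1 smulV.
Qed.
HB.instance Definition _ := isGroup.Build S smulA smul1 smulr1 smulV smulrV.

Lemma scoefM (s t : S) n : (s * t)%g n = csum n (fun i j => s i ** t j).
Proof. by []. Qed.
Lemma scoef1 n : (1%g : S) n.+1 = 0.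
Proof. by []. Qed.
End SeriesGroup.

Section SeriesMap.
Variables (K : fieldType) (V W : unitalAlgType K) (f : V -> W).
Hypothesis fh : unital_alg_hom f.
Fact smap_coef0 (s : useries V) : f (s 0%N) = bone.
Proof. by rewrite scoef0; case: fh. Qed.
Definition smap (s : useries V) : useries W :=
  @USeries K W (fun n => f (s n)) (smap_coef0 s).
Lemma smapM : {morph smap : s t / (s * t)%g}.
Proof.
case: fh => fl _ fM s t; apply: useriesP => n; rewrite /= (linear_csum fl).
by apply: eq_csum => i j; rewrite fM.
Qed.
End SeriesMap.

Lemma bilin_csum (K : fieldType) (U V W : lmodType K) (f : U -> V -> W) :
  bilin f -> forall i j F G, f (csum i F) (csum j G) =
  csum i (fun p q => csum j (fun k l => f (F p q) (G k l))).
Proof.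
move=> fb i j F G; rewrite [LHS](linear_csum (fb.2 _)).
by apply: eq_csum => p q; rewrite (linear_csum (fb.1 _)).
Qed.

Section SeriesDiag.
Variables (K : fieldType) (W : unitalAlgType K).
Fact sdiag_coef0 (s : useries W) : csum 0 (fun i j => tens (s i) (s j)) = bone.
Proof. by rewrite /csum big_ord1 !scoef0. Qed.
Definition sdiag (s : useries W) : useries (tensor W W) :=
  @USeries K (tensor W W) (fun n => csum n (fun i j => tens (s i) (s j))) (sdiag_coef0 s).
Lemma sdiagM : {morph sdiag : s t / (s * t)%g}.
Proof.
move=> s t; apply: useriesP => n; rewrite scoefM.
rewrite [LHS]/(csum n _).
rewrite [LHS](eq_csum _ (fun i j => bilin_csum (tens_bilin W W) i j _ _)) csumACA.
apply: eq_csum => i j;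
  rewrite [RHS](bilin_csum (bmul_bilin : bilin (@bmul K (tensor W W)))).
by do 2!apply: eq_csum => ? ?; rewrite tensM.
Qed.
End SeriesDiag.

Section GroupLike.
Variables (K : fieldType) (g : lieAlgType K).

Definition grouplike (x : nat -> Uenv g) :=
  forall n, Udelta (x n) = \sum_(i < n.+1) tens (x i) (x (n - i)%N).

Lemma grouplikeP (x : useries (Uenv g)) :
  grouplike x <-> smap (Udelta_hom g) x = sdiag x.
Proof.
split=> [xg|xg n]; first exact: useriesP.
by rewrite -[LHS]/(smap (Udelta_hom g) x n) xg.
Qed.

Fact grouplike_closed :
  group_closed (fun x : useries (Uenv g) => `[< grouplike x >]).
Proof.
split=> [|x y /asboolP/grouplikeP xg /asboolP/grouplikeP yg];
  apply/asboolP/grouplikeP.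
  have /mulgI -> // : (smap (Udelta_hom g) 1 * smap (Udelta_hom g) 1 = smap (Udelta_hom g) 1 * 1)%g.
    by rewrite -smapM !mulg1.
  by apply: (@mulgI _ (sdiag 1%g)); rewrite mulg1 -sdiagM mulg1.
apply: (@mulIg _ (sdiag y)); rewrite -sdiagM -{1}yg -smapM.
by rewrite -mulgA mulVg mulg1.
Qed.

(* Group-like series x = 1 + h x_1 + ...; they are automatically invertible. *)
Definition Ugl := {x : useries (Uenv g) | `[< grouplike x >]}.
HB.instance Definition _ := SubChoice.on Ugl.
HB.instance Definition _ := SubChoice_isSubGroup.Build _ _ Ugl grouplike_closed.
Definition mkUgl (x : useries (Uenv g)) (gx : grouplike x) : Ugl := exist _ x (asboolT gx).
Lemma UglP (x : Ugl) n :
  Udelta (val x n) = csum n (fun i j => tens (val x i) (val x j)).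
Proof. by case: x => x /= /asboolP ->. Qed.
End GroupLike.
Arguments mkUgl {K g} x gx.

Lemma unital_alg_hom_ext (K : fieldType) (g : lieAlgType K) (W : unitalAlgType K)
    (f f' : Uenv g -> W) : unital_alg_hom f -> unital_alg_hom f' ->
  (forall x, f (uinj x) = f' (uinj x)) -> f =1 f'.
Proof.
move=> [fl f1 fM] [fl' f1' fM'] e; elim/Uenv_ind=> //.
- by rewrite f1 f1'.
- by move=> c u ih; rewrite (linear_Z fl) (linear_Z fl') ih.
- by move=> u v ihu ihv; rewrite (linear_D fl) (linear_D fl') ihu ihv.
- by move=> u v ihu ihv; rewrite fM fM' ihu ihv.
Qed.

Section UenvXmod.
Variables (K : fieldType) (g h : lieAlgType K) (X : lie_xmod g h).

(* [Ubd] and [Uact] extend the boundary and the action of X to the enveloping *)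
(* algebras, each element of h acting on U(g) by a derivation.                *)
Definition Ubd : Uenv g -> Uenv h := Ulift (fun x => uinj (lxd X x)).
Definition Uact : Uenv h -> Uenv g -> Uenv g := Urep (fun x => Uder (lxact X x)).

Fact Ubd_gen_linear : linear (fun x : g => uinj (lxd X x)).
Proof. by move=> c x y; rewrite (lxd_linear X) (@uinj_linear _ h). Qed.
Fact Ubd_gen_brk x y : uinj (lxd X (brk x y)) =
  uinj (lxd X x) ** uinj (lxd X y) - uinj (lxd X y) ** uinj (lxd X x).
Proof. by rewrite lxd_brk uinj_brk. Qed.
Lemma Ubd_hom : unital_alg_hom Ubd.
Proof. exact: (Ulift_hom Ubd_gen_linear Ubd_gen_brk). Qed.
Lemma Ubd_inj x : Ubd (uinj x) = uinj (lxd X x).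
Proof. exact: (Ulift_inj Ubd_gen_linear Ubd_gen_brk). Qed.

Let dlin x : linear (lxact X x). Proof. exact: (lxact_bilin X).1. Qed.
Let der x := lxact_der X x.
Lemma xder_linear x : linear (Uder (lxact X x)).
Proof. exact: (Uder_linear (dlin x) (der x)). Qed.
Lemma xder_inj x a : Uder (lxact X x) (uinj a) = uinj (lxact X x a).
Proof. exact: (Uder_inj (dlin x) (der x)). Qed.
Lemma xder1 x : Uder (lxact X x) bone = 0.
Proof. exact: (Uder1 (dlin x) (der x)). Qed.
Lemma xderM x u v : Uder (lxact X x) (u ** v) =
  Uder (lxact X x) u ** v + u ** Uder (lxact X x) v.
Proof. exact: (UderM (dlin x) (der x)). Qed.

Fact xder_bilin : bilin (fun x => Uder (lxact X x)).
Proof.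
split=> [x|u c x y]; first exact: xder_linear.
elim/Uenv_ind: u => [|a|d u ih|u v ihu ihv|u v ihu ihv].
- by rewrite !xder1 scaler0 addr0.
- by rewrite !xder_inj ((lxact_bilin X).2 a) (@uinj_linear _ g).
- by rewrite !(linear_Z (xder_linear _)) ih scalerDr !scalerA mulrC.
- by rewrite !(linear_D (xder_linear _)) ihu ihv scalerDr addrACA.
- by rewrite !xderM ihu ihv bmulDl bmulDr bmulZl bmulZr scalerDr addrACA.
Qed.
Fact xder_brk x y u : Uder (lxact X (brk x y)) u =
  Uder (lxact X x) (Uder (lxact X y) u) - Uder (lxact X y) (Uder (lxact X x) u).
Proof.
have zD z := linear_D (xder_linear z).
elim/Uenv_ind: u => [|a|d u ih|u v ihu ihv|u v ihu ihv].
- by rewrite !xder1 !(linear_0 (xder_linear _)) subrr.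
- rewrite !xder_inj lxact_brk (linear_D (@uinj_linear _ g)).
  by rewrite (linear_N (@uinj_linear _ g)).
- by rewrite !(linear_Z (xder_linear _)) ih scalerBr.
- by rewrite !zD ihu ihv opprD addrACA.
- rewrite !xderM ihu ihv !zD !xderM bmulBl bmulBr.
  exact: add_cross.
Qed.

Lemma Uact_bilin : bilin Uact.
Proof. exact: (Urep_bilin xder_bilin xder_brk). Qed.
Lemma Uact_inj x u : Uact (uinj x) u = Uder (lxact X x) u.
Proof. exact: (Urep_inj xder_bilin xder_brk). Qed.
Lemma Uact1 u : Uact bone u = u.
Proof. exact: (Urep1 xder_bilin xder_brk). Qed.
Lemma UactM u v w : Uact (u ** v) w = Uact u (Uact v w).
Proof. exact: (UrepM xder_bilin xder_brk). Qed.
Lemma Uact_injinj x a : Uact (uinj x) (uinj a) = uinj (lxact X x a).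
Proof. by rewrite Uact_inj xder_inj. Qed.
Let UactDr u v w : Uact u (v + w) = Uact u v + Uact u w.
Proof. exact: (linear_D (Uact_bilin.1 u)). Qed.
Let UactDl u v w : Uact (u + v) w = Uact u w + Uact v w.
Proof. exact: (linear_D (Uact_bilin.2 w)). Qed.

(* u |> (a a') = (u' |> a) (u'' |> a') *)
Definition act2 (a a' : Uenv g) : tensor (Uenv h) (Uenv h) -> Uenv g :=
  tlift (fun p q => Uact p a ** Uact q a').
Fact act2_bilin a a' : bilin (fun p q => Uact p a ** Uact q a').
Proof.
split=> [p c q q'|q c p p'] /=.
  by rewrite (Uact_bilin.2 a') bmulDr bmulZr.
by rewrite (Uact_bilin.2 a) bmulDl bmulZl.
Qed.
Fact act2_linear a a' : linear (act2 a a').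
Proof. exact/tlift_linear/act2_bilin. Qed.
Fact act2_tens a a' p q : act2 a a' (tens p q) = Uact p a ** Uact q a'.
Proof. exact/tlift_tens/act2_bilin. Qed.
Lemma Uact_mul u a a' : Uact u (a ** a') = act2 a a' (Udelta u).
Proof.
have [Dl D1 DM] := Udelta_hom h; have AD a1 a2 := linear_D (act2_linear a1 a2).
elim/Uenv_ind: u a a' => [|x|c u ih|u v ihu ihv|u v ihu ihv] a a'.
- by rewrite D1 act2_tens !Uact1.
- by rewrite Udelta_inj AD !act2_tens !Uact1 !Uact_inj xderM.
- by rewrite (linear_Z Dl) (linear_Z (act2_linear _ _)) -ih (linear_Z (Uact_bilin.2 _)).
- by rewrite (linear_D Dl) AD -ihu -ihv UactDl.
rewrite UactM ihv DM; elim/tensor_ind: (Udelta v) => [p q|x y ihx ihy];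
  last first.
  by rewrite AD UactDr ihx ihy bmulDr AD.
rewrite act2_tens ihu; elim/tensor_ind: (Udelta u) => [p' q'|x y ihx ihy].
  by rewrite tensM !act2_tens !UactM.
by rewrite AD ihx ihy bmulDl AD.
Qed.

(* Delta (u |> a) = (u' |> a') (x) (u'' |> a'') *)
Definition tact_pure p q : tensor (Uenv g) (Uenv g) -> tensor (Uenv g) (Uenv g) :=
  tlift (fun a a' => tens (Uact p a) (Uact q a')).
Fact tact_pure_bilin p q : bilin (fun a a' => tens (Uact p a) (Uact q a')).
Proof.
split=> [a c b b'|b c a a'] /=.
  by rewrite (Uact_bilin.1 q) (tens_bilin _ _).1.
by rewrite (Uact_bilin.1 p) ((tens_bilin _ _).2 _).
Qed.
Fact tact_pure_linear p q : linear (tact_pure p q).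
Proof. exact/tlift_linear/tact_pure_bilin. Qed.
Fact tact_pure_tens p q a a' : tact_pure p q (tens a a') = tens (Uact p a) (Uact q a').
Proof. exact/tlift_tens/tact_pure_bilin. Qed.
Definition tact y : tensor (Uenv h) (Uenv h) -> tensor (Uenv g) (Uenv g) :=
  tlift (fun p q => tact_pure p q y).
Fact tact_bilin y : bilin (fun p q => tact_pure p q y).
Proof.
split=> [p c q q'|q c p p']; elim/tensor_ind: y => [a a'|x y ihx ihy].
- by rewrite !tact_pure_tens (Uact_bilin.2 a') (tens_bilin _ _).1.
- by rewrite !(linear_D (tact_pure_linear _ _)) ihx ihy scalerDr addrACA.
- by rewrite !tact_pure_tens (Uact_bilin.2 a) ((tens_bilin _ _).2 _).
- by rewrite !(linear_D (tact_pure_linear _ _)) ihx ihy scalerDr addrACA.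
Qed.
Fact tact_linear y : linear (tact y).
Proof. exact/tlift_linear/tact_bilin. Qed.
Fact tact_tens y p q : tact y (tens p q) = tact_pure p q y.
Proof. exact/tlift_tens/tact_bilin. Qed.
Fact tactDl x y z : tact (x + y) z = tact x z + tact y z.
Proof.
elim/tensor_ind: z => [p q|z z' ih ih'].
  by rewrite !tact_tens (linear_D (tact_pure_linear _ _)).
by rewrite !(linear_D (tact_linear _)) ih ih' addrACA.
Qed.

Fact Udelta_xder x a : Udelta (Uder (lxact X x) a) =
  tact_pure (uinj x) bone (Udelta a) + tact_pure bone (uinj x) (Udelta a).
Proof.
have [Dl D1 DM] := Udelta_hom g; pose PL := tact_pure_linear.
elim/Uenv_ind: a => [|b|c u ih|u v ihu ihv|u v ihu ihv].
- rewrite xder1 (linear_0 Dl) D1 !tact_pure_tens !Uact_inj !xder1.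
  by rewrite (linear_0 ((tens_bilin _ _).2 _)) (linear_0 ((tens_bilin _ _).1 _)) addr0.
- rewrite xder_inj !Udelta_inj !(linear_D (PL _ _)) !tact_pure_tens !Uact1 !Uact_inj.
  rewrite !xder1 !xder_inj (linear_0 ((tens_bilin _ _).2 _)).
  by rewrite (linear_0 ((tens_bilin _ _).1 _)) addr0 add0r.
- by rewrite !(linear_Z (xder_linear _), linear_Z Dl, linear_Z (PL _ _)) ih scalerDr.
- by rewrite !(linear_D (xder_linear _), linear_D Dl, linear_D (PL _ _)) ihu ihv addrACA.
rewrite xderM (linear_D Dl) !DM ihu ihv.
have PM1 s t : tact_pure (uinj x) bone (s ** t) =
    tact_pure (uinj x) bone s ** t + s ** tact_pure (uinj x) bone t.
  elim/tensor_ind: s t => [a a' t|s s' ih ih' t]; last first.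
    by rewrite !(bmulDl, linear_D (PL _ _)) ih ih' addrACA.
  elim/tensor_ind: t => [b b'|t t' ih ih']; last first.
    by rewrite !(bmulDr, linear_D (PL _ _)) ih ih' addrACA.
  rewrite tensM !tact_pure_tens !tensM !Uact1 !Uact_inj xderM.
  exact: (linear_D ((tens_bilin _ _).2 _)).
have PM2 s t : tact_pure bone (uinj x) (s ** t) =
    tact_pure bone (uinj x) s ** t + s ** tact_pure bone (uinj x) t.
  elim/tensor_ind: s t => [a a' t|s s' ih ih' t]; last first.
    by rewrite !(bmulDl, linear_D (PL _ _)) ih ih' addrACA.
  elim/tensor_ind: t => [b b'|t t' ih ih']; last first.
    by rewrite !(bmulDr, linear_D (PL _ _)) ih ih' addrACA.
  rewrite tensM !tact_pure_tens !tensM !Uact1 !Uact_inj xderM.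
  exact: (linear_D ((tens_bilin _ _).1 _)).
by rewrite PM1 PM2 bmulDl bmulDr addrACA.
Qed.

Lemma Udelta_act u a : Udelta (Uact u a) = tact (Udelta a) (Udelta u).
Proof.
have [Dl D1 DM] := Udelta_hom h; have [Dl' _ _] := Udelta_hom g.
have TD y := linear_D (tact_linear y).
elim/Uenv_ind: u a => [|x|c u ih|u v ihu ihv|u v ihu ihv] a.
- rewrite D1 tact_tens Uact1; elim/tensor_ind: (Udelta a) => [b b'|s t ihs iht].
    by rewrite tact_pure_tens !Uact1.
  by rewrite (linear_D (tact_pure_linear _ _)) -ihs -iht.
- by rewrite Udelta_inj TD !tact_tens Uact_inj Udelta_xder.
- by rewrite (linear_Z Dl) (linear_Z (tact_linear _)) -ih (linear_Z (Uact_bilin.2 _)) (linear_Z Dl').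
- by rewrite (linear_D Dl) TD -ihu -ihv UactDl (linear_D Dl').
rewrite UactM ihu ihv DM; elim/tensor_ind: (Udelta v) => [p q|x y ihx ihy];
  last first.
  by rewrite TD tactDl ihx ihy bmulDr TD.
elim/tensor_ind: (Udelta u) => [p' q'|x y ihx ihy];
  last by rewrite TD ihx ihy bmulDl TD.
rewrite tensM !tact_tens; elim/tensor_ind: (Udelta a) => [b b'|s t ihs iht].
  by rewrite !tact_pure_tens !UactM.
by rewrite !(linear_D (tact_pure_linear _ _)) ihs iht.
Qed.

Lemma Udelta_bd u :
  Udelta (Ubd u) = tlift (fun p q => tens (Ubd p) (Ubd q)) (Udelta u).
Proof.
have [Dl D1 DM] := Udelta_hom h; have [Dl' D1' DM'] := Udelta_hom g.
have [Bl B1 BM] := Ubd_hom.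
have tb : bilin (fun p q => tens (Ubd p) (Ubd q)).
  split=> [p c q q'|q c p p'] /=; rewrite Bl;
    first by rewrite (tens_bilin _ _).1.
  by rewrite ((tens_bilin _ _).2 _).
move: u; apply: unital_alg_hom_ext => [||x].
- split=> [c u v||u v]; first by rewrite Bl Dl.
    by rewrite B1 D1.
  by rewrite BM DM.
- split=> [c u v||u v]; first by rewrite Dl' (tlift_linear tb).
    by rewrite D1' (tlift_tens tb) B1.
  rewrite DM'; elim/tensor_ind: (Udelta u) => [p q|x y ihx ihy]; last first.
    by rewrite bmulDl !(tliftD tb) ihx ihy bmulDl.
  elim/tensor_ind: (Udelta v) => [p' q'|x y ihx ihy].
    by rewrite tensM !(tlift_tens tb) tensM !BM.
  by rewrite bmulDr !(tliftD tb) ihx ihy bmulDr.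
- by rewrite Ubd_inj !Udelta_inj (tliftD tb) !(tlift_tens tb) Ubd_inj B1.
Qed.

(* (d u' |> a) u'' = u a *)
Lemma Uact_bd u a :
  tlift (fun p q => Uact (Ubd p) a ** q) (Udelta u) = u ** a.
Proof.
have [Dl D1 DM] := Udelta_hom g; have [Bl B1 BM] := Ubd_hom.
have tb b : bilin (fun p q => Uact (Ubd p) b ** q).
  split=> [p c q q'|q c p p'] /=; first by rewrite bmulDr bmulZr.
  by rewrite Bl (Uact_bilin.2 b) bmulDl bmulZl.
have TL b := tlift_linear (tb b); have TD b := tliftD (tb b);
  have TT b := tlift_tens (tb b).
elim/Uenv_ind: u a => [|x|c u ih|u v ihu ihv|u v ihu ihv] a.
- by rewrite D1 TT B1 Uact1 bmul1 bmulr1.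
- rewrite Udelta_inj TD !TT bmulr1 B1 Uact1 Ubd_inj Uact_inj.
  have -> : Uder (lxact X (lxd X x)) a = uinj x ** a - a ** uinj x.
    elim/Uenv_ind: a => [|b|c v ih|v w ihv ihw|v w ihv ihw].
    - by rewrite xder1 bmul1 bmulr1 subrr.
    - by rewrite xder_inj lx_peiffer uinj_brk.
    - by rewrite (linear_Z (xder_linear _)) ih bmulZl bmulZr scalerBr.
    - by rewrite (linear_D (xder_linear _)) ihv ihw bmulDl bmulDr opprD addrACA.
    - by rewrite xderM ihv ihw bmulBl bmulBr !bmulA addrA subrK.
  by rewrite subrK.
- by rewrite (linear_Z Dl) (linear_Z (TL _)) ih bmulZl.
- by rewrite (linear_D Dl) TD ihu ihv bmulDl.
rewrite DM -bmulA -ihv; elim/tensor_ind: (Udelta v) => [p q|x y ihx ihy];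
  last first.
  by rewrite bmulDr !TD bmulDr ihx ihy.
rewrite TT bmulA -ihu; elim/tensor_ind: (Udelta u) => [p' q'|x y ihx ihy].
  by rewrite tensM !TT BM UactM bmulA.
by rewrite bmulDl !TD ihx ihy bmulDl.
Qed.

(* d (u' |> a) u'' = u d a *)
Lemma Ubd_act u a :
  tlift (fun p q => Ubd (Uact p a) ** q) (Udelta u) = u ** Ubd a.
Proof.
have [Dl D1 DM] := Udelta_hom h; have [Bl B1 BM] := Ubd_hom.
have tb b : bilin (fun p q => Ubd (Uact p b) ** q).
  split=> [p c q q'|q c p p'] /=; first by rewrite bmulDr bmulZr.
  by rewrite (Uact_bilin.2 b) Bl bmulDl bmulZl.
have TL b := tlift_linear (tb b); have TD b := tliftD (tb b);
  have TT b := tlift_tens (tb b).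
elim/Uenv_ind: u a => [|x|c u ih|u v ihu ihv|u v ihu ihv] a.
- by rewrite D1 TT Uact1 bmul1 bmulr1.
- rewrite Udelta_inj TD !TT bmulr1 Uact1 Uact_inj.
  have -> : Ubd (Uder (lxact X x) a) = uinj x ** Ubd a - Ubd a ** uinj x.
    elim/Uenv_ind: a => [|b|c v ih|v w ihv ihw|v w ihv ihw].
    - by rewrite xder1 B1 bmul1 bmulr1 subrr (linear_0 Bl).
    - by rewrite xder_inj !Ubd_inj lxd_act uinj_brk.
    - by rewrite (linear_Z (xder_linear _)) !(linear_Z Bl) ih bmulZl bmulZr scalerBr.
    - by rewrite (linear_D (xder_linear _)) !(linear_D Bl) ihv ihw bmulDl bmulDr opprD addrACA.
    - by rewrite xderM (linear_D Bl) !BM ihv ihw bmulBl bmulBr !bmulA addrA subrK.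
  by rewrite subrK.
- by rewrite (linear_Z Dl) (linear_Z (TL _)) ih bmulZl.
- by rewrite (linear_D Dl) TD ihu ihv bmulDl.
rewrite DM -bmulA -ihv; elim/tensor_ind: (Udelta v) => [p q|x y ihx ihy];
  last first.
  by rewrite bmulDr !TD bmulDr ihx ihy.
rewrite TT bmulA -ihu; elim/tensor_ind: (Udelta u) => [p' q'|x y ihx ihy].
  by rewrite tensM !TT UactM bmulA.
by rewrite bmulDl !TD ihx ihy bmulDl.
Qed.
End UenvXmod.

Section UglXmod.
Variables (K : fieldType) (g h : lieAlgType K) (X : lie_xmod g h).

Lemma csum_exchange (V : zmodType) i j (F : nat -> nat -> nat -> nat -> V) :
  csum i (fun p q => csum j (fun k l => F p q k l)) =
  csum j (fun k l => csum i (fun p q => F p q k l)).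
Proof. exact: exchange_big. Qed.
Lemma csumAC (V : zmodType) n (F : nat -> nat -> nat -> V) :
  csum n (fun i k => csum i (fun p q => F p q k)) =
  csum n (fun i q => csum i (fun p k => F p q k)).
Proof. by rewrite !csumA; apply: eq_csum => p j; rewrite csumC. Qed.

Fact sact_coef0 (b : useries (Uenv h)) (x : useries (Uenv g)) :
  csum 0 (fun i j => Uact X (b i) (x j)) = bone.
Proof. by rewrite /csum big_ord1 !scoef0 Uact1. Qed.
Definition sact (b : useries (Uenv h)) (x : useries (Uenv g)) : useries (Uenv g) :=
  @USeries K (Uenv g) (fun n => csum n (fun i j => Uact X (b i) (x j))) (sact_coef0 b x).

Fact Ugl_bd_subproof (x : Ugl g) : grouplike (smap (Ubd_hom X) (val x)).
Proof.
have [Bl B1 BM] := Ubd_hom X.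
have tb : bilin (fun p q => tens (Ubd X p) (Ubd X q)).
  split=> [p c q q'|q c p p'] /=; rewrite Bl;
    first by rewrite (tens_bilin _ _).1.
  by rewrite ((tens_bilin _ _).2 _).
move=> n; rewrite [LHS]Udelta_bd (UglP x) (linear_bigsum (tlift_linear tb)).
by apply: eq_bigr => i _; rewrite (tlift_tens tb).
Qed.
Definition Ugl_bd (x : Ugl g) : Ugl h := mkUgl _ (Ugl_bd_subproof x).

Fact Ugl_act_subproof (b : Ugl h) (x : Ugl g) : grouplike (sact (val b) (val x)).
Proof.
have [Dl _ _] := Udelta_hom g.
move=> n; rewrite [LHS](linear_csum Dl) 
  -[RHS]/(csum n (fun i j => tens (sact (val b) (val x) i) (sact (val b) (val x) j))).
rewrite [RHS](eq_csum _ (fun i j => bilin_csum (tens_bilin _ _) i j _ _)) -csumACA.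
apply: eq_csum => i j;
  rewrite Udelta_act (UglP x) (UglP b) [LHS](linear_csum (tact_linear _ _)).
apply: eq_csum => p q;
  rewrite tact_tens [LHS](linear_csum (tact_pure_linear _ _ _)).
by apply: eq_csum => k l; rewrite tact_pure_tens.
Qed.
Definition Ugl_act (b : Ugl h) (x : Ugl g) : Ugl g := mkUgl _ (Ugl_act_subproof b x).

Fact Ugl_bdM : {morph Ugl_bd : x y / (x * y)%g}.
Proof. by move=> x y; apply: val_inj; rewrite /= smapM. Qed.
Fact Ugl_act1 x : Ugl_act 1%g x = x.
Proof.
apply/val_inj/useriesP => n /=; rewrite /csum big_ord_recl /= Uact1 subn0.
by rewrite big1 ?addr0 // => i _; rewrite (linear_0 ((Uact_bilin X).2 _)).
Qed.
Fact Ugl_actM b b' x : Ugl_act (b * b')%g x = Ugl_act b (Ugl_act b' x).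
Proof.
apply/val_inj/useriesP => n /=.
rewrite (eq_csum _ (fun i j => linear_csum ((Uact_bilin X).2 _) _ _)) csumA.
apply: eq_csum => p j; rewrite (linear_csum ((Uact_bilin X).1 _)).
by apply: eq_csum => q k; rewrite UactM.
Qed.
Fact Ugl_act_mul b : {morph Ugl_act b : x y / (x * y)%g}.
Proof.
move=> x y; apply/val_inj/useriesP => n /=.
rewrite [RHS](eq_csum _ (fun i j => bilin_csum bmul_bilin i j _ _)) -csumACA.
apply: eq_csum => i j; rewrite (linear_csum ((Uact_bilin X).1 _)) csum_exchange.
apply: eq_csum => k l;
  rewrite Uact_mul (UglP b) [LHS](linear_csum (act2_linear _ _ _)).
by apply: eq_csum => p q; rewrite act2_tens.
Qed.
Fact Ugl_bd_act b x : Ugl_bd (Ugl_act b x) = (b * Ugl_bd x * b^-1)%g.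
Proof.
have [Bl _ _] := Ubd_hom X.
have tb a : bilin (fun p q => Ubd X (Uact X p a) ** q).
  split=> [p c q q'|q c p p'] /=; first by rewrite bmulDr bmulZr.
  by rewrite ((Uact_bilin X).2 a) Bl bmulDl bmulZl.
apply: (@mulIg _ b); rewrite mulgVK; apply/val_inj/useriesP => n /=.
transitivity (csum n (fun i q => csum i (fun p k => Ubd X (Uact X (val b p) (val x k)) ** val b q))).
  apply: eq_csum => i j; rewrite (linear_csum Bl).
  by rewrite [LHS](linear_csum (bmul_bilin.2 _)).
rewrite csumAC; apply: eq_csum => i j.
rewrite -Ubd_act (UglP b) [RHS](linear_csum (tlift_linear (tb _))).
by apply: eq_csum => p q; rewrite (tlift_tens (tb _)).
Qed.
Fact Ugl_peiffer x y : Ugl_act (Ugl_bd x) y = (x * y * x^-1)%g.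
Proof.
have [Bl _ _] := Ubd_hom X.
have tb a : bilin (fun p q => Uact X (Ubd X p) a ** q).
  split=> [p c q q'|q c p p'] /=; first by rewrite bmulDr bmulZr.
  by rewrite Bl ((Uact_bilin X).2 a) bmulDl bmulZl.
apply: (@mulIg _ x); rewrite mulgVK; apply/val_inj/useriesP => n /=.
transitivity (csum n (fun i q => csum i (fun p k => Uact X (Ubd X (val x p)) (val y k) ** val x q))).
  by apply: eq_csum => i j; rewrite [LHS](linear_csum (bmul_bilin.2 _)).
rewrite csumAC; apply: eq_csum => i j.
rewrite -(Uact_bd X) (UglP x) [RHS](linear_csum (tlift_linear (tb _))).
by apply: eq_csum => p q; rewrite (tlift_tens (tb _)).
Qed.
Definition Ugl_xmod : group_xmod :=
  GroupXmod Ugl_bdM Ugl_act1 Ugl_actM Ugl_act_mul Ugl_bd_act Ugl_peiffer.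
End UglXmod.

Definition adjoin1 (K : fieldType) (A : bareAlgType K) : Type := (K^o * A)%type.
Section Adjoin.
Variables (K : fieldType) (A : bareAlgType K).
Local Notation A1 := (adjoin1 A).
HB.instance Definition _ := GRing.Lmodule.on A1.
Definition amul (x y : A1) : A1 :=
  (x.1 * y.1, (x.1 : K) *: y.2 + (y.1 : K) *: x.2 + x.2 ** y.2).
Definition aone : A1 := (1, 0).
Fact amulA : associative amul.
Proof.
case=> [c a] [d b] [e f]; rewrite /amul /=; congr pair; first exact: mulrA.
rewrite !scalerDr !bmulDl !bmulDr !bmulZl !bmulZr !scalerA bmulA !addrA.
rewrite (mulrC e c) (mulrC e d).
by rewrite [LHS](ACl (1*2*4*6*3*5*7)%AC).
Qed.
Fact amul_bilin : bilin amul.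
Proof.
split=> [[c a] k [d b] [e f]|[c a] k [d b] [e f]]; congr pair => /=.
- by rewrite mulrDr /GRing.scale /= mulrCA.
- rewrite scalerDl bmulDr bmulZr !scalerDr !scalerA (mulrC c k).
  by rewrite [RHS](AC (3*3) ((1*4)*(2*5)*(3*6)))%AC.
- by rewrite mulrDl /GRing.scale /= mulrA.
- rewrite scalerDl bmulDl bmulZl !scalerDr !scalerA (mulrC c k).
  by rewrite [RHS](AC (3*3) ((1*4)*(2*5)*(3*6)))%AC.
Qed.
Fact amul1 : left_id aone amul.
Proof.
by case=> c a; rewrite /amul /= mul1r scale1r scaler0 addr0 bmul0l addr0.
Qed.
Fact amulr1 : right_id aone amul.
Proof.
by case=> c a; rewrite /amul /= mulr1 scale1r scaler0 add0r bmul0r addr0.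
Qed.
HB.instance Definition _ := isBareAlgebra.Build K A1 amulA amul_bilin.
HB.instance Definition _ := hasIdentity.Build K A1 amul1 amulr1.

Lemma adjoin1M (x y : A1) :
  x ** y = (x.1 * y.1, (x.1 : K) *: y.2 + (y.1 : K) *: x.2 + x.2 ** y.2) :> A1.
Proof. by []. Qed.

Definition in_ideal (s : nat -> A1) := forall n, (0 < n)%N -> (s n).1 = 0.
Lemma fst_csum n (F : nat -> nat -> A1) : (csum n F).1 = csum n (fun i j => (F i j).1).
Proof. exact: (@linear_csum K A1 K^o fst). Qed.
Fact in_ideal_closed : group_closed (fun s : useries A1 => `[< in_ideal s >]).
Proof.
split=> [|x y /asboolP xI /asboolP yI]; apply/asboolP; first by case.
move=> n n_gt0; have := congr1 (fun s : useries A1 => (s n).1) (mulgVK y x).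
rewrite /= fst_csum csum_recr scoef0 /= mulr1 xI //.
by rewrite big1 ?add0r // => i _; rewrite yI ?mulr0 // subn_gt0.
Qed.
(* The series 1 + h a_1 + h^2 a_2 + ... with all a_n in A. *)
Definition Astar := {s : useries A1 | `[< in_ideal s >]}.
HB.instance Definition _ := SubChoice.on Astar.
HB.instance Definition _ := SubChoice_isSubGroup.Build _ _ Astar in_ideal_closed.
Definition mkAstar (s : useries A1) (sI : in_ideal s) : Astar := exist _ s (asboolT sI).
Lemma AstarP (s : Astar) n : (val s n).1 = (n == 0%N)%:R.
Proof.
case: s => s /= /asboolP sI; case: n => [|n]; last exact: sI.
by rewrite scoef0.
Qed.
Lemma Astar_inj (s t : Astar) : (forall n, (val s n).2 = (val t n).2) -> s = t.
Proof.
move=> st; apply/val_inj/useriesP => n.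
by move: (AstarP s n) (AstarP t n) (st n);
  case: (val s n) (val t n) => [c a] [d b] /= -> -> ->.
Qed.
End Adjoin.
Arguments mkAstar {K A} s sI.

Section AstarXmod.
Variables (K : fieldType) (A : bareAlgType K) (B : unitalAlgType K).
Variables (X : bare_xmod A B) (hX : unital_bare_xmod X).

(* The unital algebra map extending [bxd X]. *)
Definition adjoin1_bd (x : adjoin1 A) : B := (x.1 : K) *: bone + bxd X x.2.

Fact adjoin1_bd_hom : unital_alg_hom adjoin1_bd.
Proof.
have dl := bxd_linear X; rewrite /adjoin1_bd;
  split=> [k [c a] [d b]||[c a] [d b]] /=.
- by rewrite dl scalerDl -scalerA scalerDr addrACA.
- by rewrite (linear_0 dl) scale1r addr0.
rewrite !bmulDl !bmulDr !bmulZl !bmulZr bmul1 bmulr1 bmul1 !scalerA.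
by rewrite !(linear_D dl) !(linear_Z dl) bxdM !addrA.
Qed.

(* The coefficient of h^n in b a b^-1, for x = 1 + a and the actions of B on A *)
(* extended to series.                                                         *)
Definition conj_coef (b : useries B) (x : useries (adjoin1 A)) n : A :=
  csum n (fun m k => bxr X (csum m (fun i j => bxl X (b i) (x j).2)) ((b^-1)%g k)).
Fact conj_coef0 b x : (1%g : useries (adjoin1 A)) 0%N + ((0, conj_coef b x 0) : adjoin1 A) = bone.
Proof.
rewrite /conj_coef /csum !big_ord1 !scoef0 /= hX.1 hX.2; congr pair;
  rewrite ?addr0 ?add0r //.
Qed.
Definition conj_act (b : useries B) (x : useries (adjoin1 A)) : useries (adjoin1 A) :=
  @USeries K (adjoin1 A)
    (fun n => (1%g : useries (adjoin1 A)) n + ((0, conj_coef b x n) : adjoin1 A))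
    (conj_coef0 b x).
Fact conj_act_subproof b x : in_ideal (conj_act b x).
Proof. by case=> // n _; rewrite /= addr0. Qed.

Definition Astar_bd (x : Astar A) : useries B := smap adjoin1_bd_hom (val x).
Definition Astar_act (b : useries B) (x : Astar A) : Astar A :=
  mkAstar _ (conj_act_subproof b (val x)).

(* The algebra B (+) A, in which the action becomes conjugation; it serves *)
(* only to prove the crossed module axioms.                                *)
Definition semi of unital_bare_xmod X : Type := (B * A)%type.
Local Notation E := (semi hX).
HB.instance Definition _ := GRing.Lmodule.on E.
Definition emul (x y : E) : E :=
  (x.1 ** y.1, bxl X x.1 y.2 + bxr X x.2 y.1 + x.2 ** y.2).
Definition eone : E := (bone, 0).
Fact emulA : associative emul.
Proof.
case=> [b a] [b' a'] [b'' a'']; rewrite /emul /=; congr pair;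
  first exact: bmulA.
have lD c := linear_D ((bxl_bilin X).1 c);
  have rD c := linear_D ((bxr_bilin X).2 c).
rewrite !lD (rD b'' _ (a ** a')) (rD b'' (bxl X b a')) !bmulDl !bmulDr.
rewrite bxlM bxrM bxlr bxl_mul bxr_mul bxr_mull bmulA !addrA.
by rewrite [LHS](ACl (1*2*4*6*3*5*7)%AC).
Qed.
Fact emul_bilin : bilin emul.
Proof.
split=> [[b a] k [b' a'] [b'' a'']|[b a] k [b' a'] [b'' a'']]; congr pair => /=.
- by rewrite bmulDr bmulZr.
- rewrite (bxl_bilin X).1 (bxr_bilin X).1 bmulDr bmulZr !scalerDr.
  by rewrite [RHS](AC (3*3) ((1*4)*(2*5)*(3*6)))%AC.
- by rewrite bmulDl bmulZl.
- rewrite ((bxl_bilin X).2 a) ((bxr_bilin X).2 b) bmulDl bmulZl !scalerDr.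
  by rewrite [RHS](AC (3*3) ((1*4)*(2*5)*(3*6)))%AC.
Qed.
Fact bxl0 b : bxl X b 0 = 0. Proof. exact: (linear_0 ((bxl_bilin X).1 b)). Qed.
Fact bx0l a : bxl X 0 a = 0. Proof. exact: (linear_0 ((bxl_bilin X).2 a)). Qed.
Fact bxr0 a : bxr X a 0 = 0. Proof. exact: (linear_0 ((bxr_bilin X).1 a)). Qed.
Fact bx0r b : bxr X 0 b = 0. Proof. exact: (linear_0 ((bxr_bilin X).2 b)). Qed.
Fact emul1 : left_id eone emul.
Proof. by case=> b a; rewrite /emul /= bmul1 hX.1 bx0r bmul0l !addr0. Qed.
Fact emulr1 : right_id eone emul.
Proof. by case=> b a; rewrite /emul /= bmulr1 hX.2 bxl0 bmul0r add0r addr0. Qed.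
HB.instance Definition _ := isBareAlgebra.Build K E emulA emul_bilin.
HB.instance Definition _ := hasIdentity.Build K E emul1 emulr1.

Definition eB (b : B) : E := (b, 0).
Definition eA (x : adjoin1 A) : E := ((x.1 : K) *: bone, x.2).
Definition eP (x : E) : B := x.1.
Definition eQ (x : E) : B := x.1 + bxd X x.2.
Fact eB_hom : unital_alg_hom eB.
Proof.
split=> [c x y||x y] //; rewrite /eB; first by congr pair;
  rewrite /= scaler0 addr0.
by congr pair; rewrite /= bxl0 bx0r bmul0l !addr0.
Qed.
Fact eA_hom : unital_alg_hom eA.
Proof.
split=> [k [c a] [d b]||[c a] [d b]]; congr pair => /=; rewrite ?scale1r //.
- by rewrite scalerDl scalerA.
- by rewrite bmulZl bmulZr bmul1 scalerA.
rewrite (linear_Z ((bxl_bilin X).2 _)) hX.1.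
by rewrite (linear_Z ((bxr_bilin X).1 _)) hX.2.
Qed.
Fact eP_hom : unital_alg_hom eP. Proof. by []. Qed.
Fact eQ_hom : unital_alg_hom eQ.
Proof.
have dl := bxd_linear X; rewrite /eQ;
  split=> [k [b a] [b' a']||[b a] [b' a']] /=.
- by rewrite dl scalerDr addrACA.
- by rewrite (linear_0 dl) addr0.
by rewrite !(linear_D dl) bxd_bxl bxd_bxr bxdM bmulDl !bmulDr !addrA.
Qed.
Local Notation iB := (smap eB_hom).
Local Notation iA := (smap eA_hom).
Local Notation pP := (smap eP_hom).
Local Notation pQ := (smap eQ_hom).

Fact smap1 (U V : unitalAlgType K) (f : U -> V) (fh : unital_alg_hom f) : smap fh 1%g = 1%g.
Proof. by apply: (@mulgI _ (smap fh 1%g)); rewrite -smapM !mulg1. Qed.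
Fact smapV (U V : unitalAlgType K) (f : U -> V) (fh : unital_alg_hom f) s :
  smap fh (s^-1)%g = ((smap fh s)^-1)%g.
Proof. by apply: (@mulgI _ (smap fh s)); rewrite -smapM !mulgV smap1. Qed.

Fact pP_iB b : pP (iB b) = b. Proof. exact: useriesP. Qed.
Fact pQ_iB b : pQ (iB b) = b.
Proof.
by apply: useriesP => n; rewrite /= /eQ /= (linear_0 (bxd_linear X)) addr0.
Qed.
Fact pQ_iA x : pQ (iA x) = smap adjoin1_bd_hom x. Proof. exact: useriesP. Qed.
Fact pP_iA (x : Astar A) : pP (iA (val x)) = 1%g.
Proof.
apply: useriesP => n; rewrite /= /eP /= AstarP; case: n => [|n] /=;
  first by rewrite scale1r.
by rewrite scale0r.
Qed.
Fact iA_inj (x y : Astar A) : iA (val x) = iA (val y) -> x = y.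
Proof.
by move=> e; apply: Astar_inj => n;
  have := congr1 (fun s : useries E => (s n).2) e.
Qed.
Fact snd_csumE n (F : nat -> nat -> E) : (csum n F).2 = csum n (fun i j => (F i j).2).
Proof. exact: (@linear_csum K E A snd). Qed.

Fact iA_act b x : iA (val (Astar_act b x)) = (iB b * iA (val x) * (iB b)^-1)%g.
Proof.
rewrite -smapV; apply: useriesP => n.
rewrite [LHS]surjective_pairing [RHS]surjective_pairing; congr pair.
  rewrite -[LHS]/(pP (iA (val (Astar_act b x))) n) pP_iA.
  rewrite -[RHS]/(pP (iB b * iA (val x) * iB (b^-1))%g n).
  by rewrite !smapM pP_iA !pP_iB mulg1 mulgV.
rewrite scoefM snd_csumE.
transitivity (conj_coef b (val x) n); first by case: n => [|n] /=;
  rewrite add0r.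
apply: eq_csum => m k; rewrite [RHS]/= bxl0 bmul0r add0r addr0;
  congr (bxr X _ _).
rewrite snd_csumE; apply: eq_csum => i j /=.
by rewrite bx0r bmul0l !addr0.
Qed.

Fact Astar_bdM : {morph Astar_bd : x y / (x * y)%g}.
Proof. by move=> x y; rewrite /Astar_bd -smapM. Qed.
Fact Astar_act1 x : Astar_act 1%g x = x.
Proof. by apply: iA_inj; rewrite iA_act smap1 mul1g invg1 mulg1. Qed.
Fact Astar_actM b b' x : Astar_act (b * b')%g x = Astar_act b (Astar_act b' x).
Proof. by apply: iA_inj; rewrite !iA_act smapM invgM !mulgA. Qed.
Fact Astar_act_mul b : {morph Astar_act b : x y / (x * y)%g}.
Proof.
move=> x y; apply: iA_inj; rewrite iA_act !valM !smapM !iA_act.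
by rewrite !mulgA mulgVK.
Qed.
Fact Astar_bd_act b x : Astar_bd (Astar_act b x) = (b * Astar_bd x * b^-1)%g.
Proof. by rewrite /Astar_bd -!pQ_iA iA_act !smapM smapV pQ_iB. Qed.
Fact Astar_peiffer x y : Astar_act (Astar_bd x) y = (x * y * x^-1)%g.
Proof.
apply: iA_inj; rewrite iA_act !valM !smapM.
have -> : iA (val x^-1)%g = ((iA (val x))^-1)%g.
  by rewrite -smapV; congr (iA _); apply: (@mulgI _ (val x));
    rewrite -valM !mulgV.
set u := iB _; set v := iA (val x); set w := (v^-1 * u)%g.
have pw n : eQ (w n.+1) = 0.
  rewrite -[LHS]/(pQ w n.+1) /w smapM smapV /u /v pQ_iB pQ_iA.
  by rewrite -[smap _ _]/(Astar_bd x) mulVg.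
have wy : (w * iA (val y) = iA (val y) * w)%g.
  apply: useriesP => n; rewrite !scoefM [RHS]csumC; apply: eq_csum => i j.
  case: i => [|i]; first by rewrite scoef0 bmul1 bmulr1.
  case: j => [|j]; first by rewrite [iA _ _]scoef0 bmul1 bmulr1.
  have -> : iA (val y) j.+1 = (0, (val y j.+1).2).
    by rewrite /= /eA AstarP scale0r.
  have := pw i; rewrite /eQ; case: (w i.+1) => b a /= /eqP;
    rewrite addr_eq0 => /eqP ->.
  congr pair => /=; first by rewrite bmul0l bmul0r.
  rewrite bxr0 bx0l (linear_N ((bxl_bilin X).2 _)) (linear_N ((bxr_bilin X).1 _)).
  by rewrite bxl_bxd bxr_bxd addr0 add0r !addNr.
have uE : u = (v * w)%g by rewrite /w mulVKg.
rewrite {}uE; clearbody w; by rewrite -(mulgA v w) wy invgM !mulgA mulgK.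
Qed.
Definition Astar_xmod : group_xmod :=
  GroupXmod Astar_bdM Astar_act1 Astar_actM Astar_act_mul Astar_bd_act Astar_peiffer.
End AstarXmod.

Definition xiB (K : fieldType) (B : unitalAlgType K) : Uenv (lie_of B) -> B :=
  Ulift (fun b : lie_of B => (b : B)).
Definition xiA (K : fieldType) (A : bareAlgType K) : Uenv (lie_of A) -> adjoin1 A :=
  Ulift (fun a : lie_of A => ((0, (a : A)) : adjoin1 A)).
Section Projections.
Variables (K : fieldType) (A : bareAlgType K) (B : unitalAlgType K).

Lemma xiB_hom : unital_alg_hom (@xiB K B).
Proof. exact: Ulift_hom. Qed.
Lemma xiB_inj (b : lie_of B) : xiB (uinj b) = (b : B).
Proof. exact: (@Ulift_inj K (lie_of B) B). Qed.
Fact xiA_gen_linear : linear (fun a : lie_of A => ((0, (a : A)) : adjoin1 A)).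
Proof. by move=> c a b; congr pair; rewrite /= scaler0 addr0. Qed.
Fact xiA_gen_brk (a b : lie_of A) (i := fun a : lie_of A => ((0, (a : A)) : adjoin1 A)) :
  i (brk a b) = i a ** i b - i b ** i a.
Proof. by congr pair; rewrite /= ?mul0r ?subrr // !scale0r !add0r. Qed.
Lemma xiA_hom : unital_alg_hom (@xiA K A).
Proof. exact: (Ulift_hom xiA_gen_linear xiA_gen_brk). Qed.
Lemma xiA_inj (a : lie_of A) : xiA (uinj a) = (0, (a : A)).
Proof. exact: (Ulift_inj xiA_gen_linear xiA_gen_brk). Qed.
End Projections.

(* Main.v *)
(** The only identity that is not formal concerns the actions.  Inside the
algebra [semi hX] = B (+) A the action of [B^*] on [A_bullet^*] is conjugation,
so it suffices that xi_A (u' |> a) xi_B u'' = xi_B u xi_A a there, where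
[Delta u = u' (x) u''].  For u in Lie(B) this says that the derivation u |> _ is
an inner derivation of B (+) A, and it propagates to all u because [Delta] is
multiplicative; a group-like b then satisfies
xi_A (b |> x) xi_B b = xi_B b xi_A x. *)
Require Import Defs.
From mathcomp Require Import all_boot all_order all_algebra.
From mathcomp Require Import reals complex.

Set Implicit Arguments.
Unset Strict Implicit.
Unset Printing Implicit Defensive.

Import GRing.Theory.
Local Open Scope ring_scope.

Lemma unital_alg_hom_comp (K : fieldType) (U V W : unitalAlgType K)
    (f : V -> W) (k : U -> V) :
  unital_alg_hom f -> unital_alg_hom k -> unital_alg_hom (f \o k).
Proof.
move=> [fl f1 fM] [kl k1 kM]; split=> [c x y||x y] /=.
- by rewrite kl fl.
- by rewrite k1 f1.
- by rewrite kM fM.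
Qed.

Section Augmentation.
Variables (K : fieldType) (A : bareAlgType K).
Implicit Types u v : Uenv (lie_of A).

(** The augmentation of [adjoin1 A], with the scalars kept as multiples of the identity, so that it
    is an endomorphism with commutative image. *)
Definition adjoin1_aug (x : adjoin1 A) : adjoin1 A := (x.1, 0).

Lemma adjoin1_aug_hom : unital_alg_hom adjoin1_aug.
Proof.
split=> [c x y||x y] //; congr pair; rewrite /= ?scaler0 ?addr0 //.
by rewrite bmul0l addr0.
Qed.

Lemma adjoin1_augC (x y : adjoin1 A) :
  adjoin1_aug x ** adjoin1_aug y = adjoin1_aug y ** adjoin1_aug x.
Proof. by congr pair; rewrite /= ?scaler0 ?bmul0l // mulrC. Qed.

Local Notation e := (adjoin1_aug \o @xiA K A).
Let e_hom : unital_alg_hom e.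
Proof. exact: unital_alg_hom_comp adjoin1_aug_hom (xiA_hom A). Qed.

(** Both sides are unital algebra maps in [u], the left one because the image of [e] is commutative,
    and both vanish on the generators. *)
Lemma aug_Udelta u : tlift (fun p q => e p ** e q) (Udelta u) = e u.
Proof.
have [Dl D1 DM] := Udelta_hom (lie_of A); have [el e1 eM] := e_hom.
have tb : bilin (fun p q => e p ** e q).
  by split=> [p|q] c x y; rewrite el ?bmulDr ?bmulZr // bmulDl bmulZl.
have TL := tlift_linear tb; have TD := tliftD tb; have TT := tlift_tens tb.
apply: (unital_alg_hom_ext (f := fun u => tlift _ (Udelta u))) e_hom _ u => [|x].
  split=> [c x y||x y]; first by rewrite Dl TL.
    by rewrite D1 TT e1 bmul1.
  rewrite DM; elim/tensor_ind: (Udelta x) => [p q|s t ihs iht]; last first.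
    by rewrite bmulDl !TD ihs iht bmulDl.
  elim/tensor_ind: (Udelta y) => [p' q'|s t ihs iht]; last first.
    by rewrite bmulDr !TD ihs iht bmulDr.
  rewrite tensM !TT !eM !bmulA; congr (_ ** _).
  by rewrite -!bmulA; congr (_ ** _); apply: adjoin1_augC.
rewrite Udelta_inj TD !TT e1 bmul1 bmulr1 /= xiA_inj.
by congr pair; rewrite addr0.
Qed.

(* Delta x = x (x) x makes the augmentation of x an idempotent of the group *)
(* of series, hence the identity.                                            *)
Lemma xiA_in_ideal (x : Ugl (lie_of A)) :
  in_ideal (smap (xiA_hom A) (val x)).
Proof.
have [el _ _] := e_hom; pose s := smap e_hom (val x).
have tb : bilin (fun p q => e p ** e q).
  by split=> [p|q] c u v; rewrite el ?bmulDr ?bmulZr // bmulDl bmulZl.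
have ss : (s * s = s)%g.
  apply: useriesP => n; rewrite [RHS]/= -[RHS]aug_Udelta UglP.
  rewrite [RHS](linear_csum (tlift_linear tb)).
  by apply: eq_csum => i j; rewrite (tlift_tens tb).
have s1 : s = 1%g by apply: (@mulgI _ s); rewrite ss mulg1.
by case=> // n _; have := congr1 (fun s : useries (adjoin1 A) => (s n.+1).1) s1.
Qed.
End Augmentation.

(** A common target [W] lets values of [f] and [k] be multiplied; [Ubd_act] is the case [f = Ubd X],
    [k = id]. *)
Lemma hom_Uact_Udelta (K : fieldType) (g h : lieAlgType K) (X : lie_xmod g h)
    (W : unitalAlgType K) (f : Uenv g -> W) (k : Uenv h -> W) :
  unital_alg_hom f -> unital_alg_hom k ->
  (forall x a, f (uinj (lxact X x a)) =
     k (uinj x) ** f (uinj a) - f (uinj a) ** k (uinj x)) ->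
  forall u a, tlift (fun p q => f (Uact X p a) ** k q) (Udelta u) = k u ** f a.
Proof.
move=> [fl f1 fM] [kl k1 kM] fk u a.
have [Dl D1 DM] := Udelta_hom h.
have tb b : bilin (fun p q => f (Uact X p b) ** k q).
  split=> [p c q q'|q c p p'] /=; first by rewrite kl bmulDr bmulZr.
  by rewrite ((Uact_bilin X).2 b) fl bmulDl bmulZl.
have TL b := tlift_linear (tb b); have TD b := tliftD (tb b);
  have TT b := tlift_tens (tb b).
(* Both sides are derivations along [f], so agreement on generators suffices. *)
have inner x b :
    f (Uder (lxact X x) b) = k (uinj x) ** f b - f b ** k (uinj x).
  elim/Uenv_ind: b => [|b|c v ih|v w ihv ihw|v w ihv ihw].
  - by rewrite xder1 f1 bmul1 bmulr1 subrr (linear_0 fl).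
  - by rewrite xder_inj fk.
  - by rewrite (linear_Z (xder_linear X _)) !(linear_Z fl) ih bmulZl bmulZr scalerBr.
  - rewrite (linear_D (xder_linear X _)) !(linear_D fl) ihv ihw.
    by rewrite bmulDl bmulDr opprD addrACA.
  - by rewrite xderM (linear_D fl) !fM ihv ihw bmulBl bmulBr !bmulA addrA subrK.
elim/Uenv_ind: u a => [|x|c u ih|u v ihu ihv|u v ihu ihv] a.
- by rewrite D1 TT k1 Uact1 bmul1 bmulr1.
- by rewrite Udelta_inj TD !TT k1 bmulr1 Uact1 Uact_inj inner subrK.
- by rewrite (linear_Z Dl) (linear_Z (TL _)) ih (linear_Z kl) bmulZl.
- by rewrite (linear_D Dl) TD ihu ihv (linear_D kl) bmulDl.
(* Move [k v] past [f a] first, then [k u] past [f (Uact X p a)]; the second move needs the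
   hypothesis on [u] at an argument other than [a]. *)
rewrite DM kM -bmulA -ihv; elim/tensor_ind: (Udelta v) => [p q|y z ihy ihz];
  last by rewrite bmulDr !TD bmulDr ihy ihz.
rewrite TT bmulA -ihu; elim/tensor_ind: (Udelta u) => [p' q'|y z ihy ihz].
  by rewrite tensM !TT UactM kM bmulA.
by rewrite bmulDl !TD ihy ihz bmulDl.
Qed.

Section Projection.
Variables (K : fieldType) (A : bareAlgType K) (B : unitalAlgType K).
Variables (X : bare_xmod A B) (hX : unital_bare_xmod X).
Local Notation LX := (lie_xmod_of X).

Definition proj_top (x : Ugl (lie_of A)) : Astar A :=
  mkAstar _ (xiA_in_ideal x).
Definition proj_base (b : Ugl (lie_of B)) : useries B :=
  smap (xiB_hom B) (val b).

Lemma proj_topM : {morph proj_top : x y / (x * y)%g}.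
Proof. by move=> x y; apply: val_inj; rewrite [LHS]smapM. Qed.

Lemma proj_baseM : {morph proj_base : b c / (b * c)%g}.
Proof. by move=> b c; rewrite /proj_base -smapM. Qed.

(** Two unital algebra maps out of the enveloping algebra, both sending a generator [a] to
    [bxd X a]. *)
Lemma adjoin1_bd_xiA u : adjoin1_bd X (xiA u) = xiB (Ubd LX u).
Proof.
move: u; apply: (unital_alg_hom_ext (f := adjoin1_bd X \o @xiA K A)
  (f' := @xiB K B \o Ubd LX)) => [||x].
- exact: unital_alg_hom_comp (adjoin1_bd_hom X) (xiA_hom A).
- exact: unital_alg_hom_comp (xiB_hom B) (Ubd_hom LX).
by rewrite /= xiA_inj Ubd_inj xiB_inj /adjoin1_bd scale0r add0r.
Qed.

Lemma proj_bd x : Astar_bd X (proj_top x) = proj_base (Ugl_bd LX x).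
Proof. by apply: useriesP => n; apply: adjoin1_bd_xiA. Qed.

Lemma proj_act b x :
  proj_top (Ugl_act LX b x) = Astar_act hX (proj_base b) (proj_top x).
Proof.
apply: (iA_inj (hX := hX)); rewrite iA_act.
pose f := @eA _ _ _ _ hX \o @xiA K A; pose k := @eB _ _ _ _ hX \o @xiB K B.
have fh : unital_alg_hom f by apply: unital_alg_hom_comp (eA_hom hX) (xiA_hom A).
have kh : unital_alg_hom k by apply: unital_alg_hom_comp (eB_hom hX) (xiB_hom B).
have fk y a : f (uinj (lxact LX y a)) =
    k (uinj y) ** f (uinj a) - f (uinj a) ** k (uinj y).
  (* In [semi hX] the commutator of [(y, 0)] and [(0, a)] is [(0, bxl X y a - bxr X a y)]. *)
  rewrite /f /k /= !xiA_inj xiB_inj; congr pair => /=.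
    by rewrite scale0r bmul0l bmul0r subrr.
  by rewrite bmul0l bmul0r bx0r bxl0 !addr0 add0r.
have tb a : bilin (fun p q => f (Uact LX p a) ** k q).
  have [[fl _ _] [kl _ _]] := (fh, kh).
  split=> [p c q q'|q c p p'] /=; first by rewrite kl bmulDr bmulZr.
  by rewrite ((Uact_bilin LX).2 a) fl bmulDl bmulZl.
(* Clearing the inverse leaves an identity that can be checked coefficientwise. *)
apply: (@mulIg _ (smap (eB_hom hX) (proj_base b))); rewrite mulgVK.
apply: useriesP => n; rewrite !scoefM.
transitivity (csum n (fun i q => csum i (fun p l =>
    f (Uact LX (val b p) (val x l)) ** k (val b q)))).
  have [fl _ _] := fh; apply: eq_csum => i j.
  rewrite -[smap (eA_hom hX) _ i]/(f (csum i _)) (linear_csum fl).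
  by rewrite [LHS](linear_csum (bmul_bilin.2 _)).
(* Grouping the two coefficients of [b] together produces the coproduct of [val b i], since [b] is
   group-like. *)
rewrite csumAC; apply: eq_csum => i j.
rewrite -[RHS]/(k (val b i) ** f (val x j)) -(hom_Uact_Udelta fh kh fk) UglP.
rewrite [RHS](linear_csum (tlift_linear (tb _))).
by apply: eq_csum => p q; rewrite (tlift_tens (tb _)).
Qed.

Definition proj_xmod : group_xmod_map (Ugl_xmod LX) (Astar_xmod hX) :=
  @GroupXmodMap (Ugl_xmod LX) (Astar_xmod hX) proj_top proj_base
    proj_topM proj_baseM proj_bd proj_act.
End Projection.

Theorem theorem34 (R : realType) (A : bareAlgType R[i])
    (B : unitalAlgType R[i]) (X : bare_xmod A B) (hX : unital_bare_xmod X) :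
  exists Proj : group_xmod_map (Ugl_xmod (lie_xmod_of X)) (Astar_xmod hX),
    (forall (x : Ugl (lie_of A)) (n : nat),
       scoef (val (gxm_top Proj x : Astar A)) n = xiA (scoef (val x) n)) /\
    (forall (y : Ugl (lie_of B)) (n : nat),
       scoef (gxm_base Proj y : useries B) n = xiB (scoef (val y) n)).
Proof. by exists (proj_xmod hX). Qed.
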